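(* ($\mathsf{CZF}$) Let $\mathcal{A}$ be a partial combinatory algebra (pca). If $\mathrm{WDec}(1)$ does not exist (is not a set) in $V$, then it also does not exist in $V(\mathcal{A})$, i.e. $V(\mathcal{A})\models$ ''$\mathrm{WDec}(1)$ is not a set''. In other words, $\mathsf{ADCom}$ is absolute under realizability: if $\mathsf{ADCom}$ holds in $V$, then $V(\mathcal{A})\models\mathsf{ADCom}$.
   Context: The logic is intuitionistic. $\mathsf{CZF}$ has axioms Extensionality, Pairing, Union, Infinity, the $\in$-Induction scheme, $\Delta_0$-Separation, Strong Collection (if $\forall x\in a\,\exists y\,\phi(x,y)$ then there is a set $b$ with $\forall x\in a\,\exists y\in b\,\phi(x,y)$ and $\forall y\in b\,\exists x\in a\,\phi(x,y)$), and Subset Collection (for all sets $a,b$ there is a set $c$ such that for all $u$, if $\forall x\in a\,\exists y\in b\,\phi(x,y,u)$ then there is $d\in c$ with $\forall x\in a\,\exists y\in d\,\phi(x,y,u)$ and $\forall y\in d\,\exists x\in a\,\phi(x,y,u)$). $\mathrm{WDec}(1)$ is the class of weakly decidable subsets of $1=\{0\}$: $\{b\subseteq 1\mid\forall x\in 1\,[\neg(x\in b)\lor\neg\neg(x\in b)]\}$; equivalently $\{x\subseteq 1\mid x=0\lor\neg\neg(x=1)\}$. $\mathsf{ADCom}$: $\forall x\,[\exists y\,\forall z\,(\neg\neg(z\in x)\to z\in y)\to x\subseteq 1]$. McCarty-style realizability: the pca $\mathcal{A}$ is a set, with application written by juxtaposition, with pairing combinator $\mathbf{p}$ and projections $(e)_0,(e)_1$,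 and with numerals $\mathbf{0},\mathbf{1}\in\mathcal{A}$. The class $V(\mathcal{A})=\bigcup_{\alpha\in\mathrm{Ord}}V(\mathcal{A})_\alpha$, where $V(\mathcal{A})_\alpha=\bigcup_{\beta\in\alpha}\mathcal{P}(\mathcal{A}\times V(\mathcal{A})_\beta)$ (classes in general). For $e\in\mathcal{A}$ and parameters in $V(\mathcal{A})$ (application terms are required to be defined): $e\Vdash a\in b$ iff there is $c$ with $\langle(e)_0,c\rangle\in b$ and $(e)_1\Vdash a=c$; $e\Vdash a=b$ iff for all $f,d$: $\langle f,d\rangle\in a$ implies $(e)_0f\Vdash d\in b$, and $\langle f,d\rangle\in b$ implies $(e)_1f\Vdash d\in a$; $e\Vdash\phi\land\psi$ iff $(e)_0\Vdash\phi$ and $(e)_1\Vdash\psi$; $e\Vdash\phi\lor\psi$ iff ($(e)_0=\mathbf{0}$ and $(e)_1\Vdash\phi$) or ($(e)_0=\mathbf{1}$ and $(e)_1\Vdash\psi$); $e\Vdash\neg\phi$ iff no $f\in\mathcal{A}$ satisfies $f\Vdash\phi$; $e\Vdash\phi\to\psi$ iff for all $f\in\mathcal{A}$, $f\Vdash\phi$ implies $ef\Vdash\psi$; $e\Vdash\forall x\in a\,\phi(x)$ iff for all $\langle f,c\rangle\in a$, $ef\Vdash\phi(c)$; $e\Vdash\exists x\in a\,\phi(x)$ iff there is $c$ with $\langle(e)_0,c\rangle\in a$ and $(e)_1\Vdash\phi(c)$; $e\Vdash\forall x\,\phi(x)$ iff $e\Vdash\phi(c)$ for all $c\in V(\mathcal{A})$;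 $e\Vdash\exists x\,\phi(x)$ iff $e\Vdash\phi(c)$ for some $c\in V(\mathcal{A})$. $V(\mathcal{A})\models\phi$ means that some $e\in\mathcal{A}$ satisfies $e\Vdash\phi$. *)

(* Defs.v *)
(* The result is a theorem of the intuitionistic theory CZF, and its
   hypothesis (WDec(1) is not a set) is refutable classically.  It is therefore
   stated as derivability of a sentence from CZF in first-order intuitionistic
   logic, not through the propositions of the metatheory, where classical
   axioms may be assumed and would make it vacuous. *)
From mathcomp Require Import all_boot.
From Stdlib Require List.

Set Implicit Arguments.
Unset Strict Implicit.
Unset Printing Implicit Defensive.

(** * The language of set theory *)

(* De Bruijn indices; the only terms are variables.  As in the definition of
   realizability, negation and the bounded quantifiers are primitive.  In
   [AllIn a phi] and [ExIn a phi] the bound [a] is outside the binder. *)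
Inductive form : Type :=
| Elem (x y : nat)
| Eql (x y : nat)
| And (phi psi : form)
| Or (phi psi : form)
| Imp (phi psi : form)
| Not (phi : form)
| AllIn (a : nat) (phi : form)
| ExIn (a : nat) (phi : form)
| All (phi : form)
| Ex (phi : form).

Declare Scope form_scope.
Delimit Scope form_scope with F.
Bind Scope form_scope with form.
Arguments Elem (x y)%_nat_scope.
Arguments Eql (x y)%_nat_scope.
Arguments AllIn a%_nat_scope phi%_form_scope.
Arguments ExIn a%_nat_scope phi%_form_scope.

Notation "x ∈ y" := (Elem x y) (at level 70, no associativity) : form_scope.
Notation "x ≐ y" := (Eql x y) (at level 70, no associativity) : form_scope.
Notation "¬ phi" := (Not phi) (at level 75, right associativity) : form_scope.
Notation "phi ∧ psi" := (And phi psi)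
  (at level 80, right associativity) : form_scope.
Notation "phi ∨ psi" := (Or phi psi)
  (at level 85, right associativity) : form_scope.
Notation "phi → psi" := (Imp phi psi)
  (at level 90, right associativity) : form_scope.
Notation "phi ↔ psi" := (And (Imp phi psi) (Imp psi phi))
  (at level 95, no associativity) : form_scope.

Definition scons (t : nat) (r : nat -> nat) : nat -> nat :=
  fun n => if n is m.+1 then r m else t.

Definition up (r : nat -> nat) : nat -> nat := scons 0 (fun n => (r n).+1).

(* Substitution of variables for variables. *)
Fixpoint ren (r : nat -> nat) (phi : form) : form :=
  match phi with
  | Elem x y => Elem (r x) (r y)
  | Eql x y => Eql (r x) (r y)
  | And phi psi => And (ren r phi) (ren r psi)
  | Or phi psi => Or (ren r phi) (ren r psi)
  | Imp phi psi => Imp (ren r phi) (ren r psi)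
  | Not phi => Not (ren r phi)
  | AllIn a phi => AllIn (r a) (ren (up r) phi)
  | ExIn a phi => ExIn (r a) (ren (up r) phi)
  | All phi => All (ren (up r) phi)
  | Ex phi => Ex (ren (up r) phi)
  end.

Definition shift (phi : form) : form := ren S phi.
Definition inst (t : nat) (phi : form) : form := ren (scons t id) phi.

Fixpoint Delta0 (phi : form) : bool :=
  match phi with
  | Elem _ _ | Eql _ _ => true
  | And phi psi | Or phi psi | Imp phi psi => Delta0 phi && Delta0 psi
  | Not phi | AllIn _ phi | ExIn _ phi => Delta0 phi
  | All _ | Ex _ => false
  end.

(** * Intuitionistic natural deduction with equality *)

(* The axioms in [T] may have free variables, which count as universally
   quantified: an axiom can be used in any context. *)
Inductive prv (T : form -> Prop) : seq form -> form -> Prop :=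
| prv_ax G phi : T phi -> prv T G phi
| prv_hyp G phi : List.In phi G -> prv T G phi
| prv_andI G phi psi : prv T G phi -> prv T G psi -> prv T G (And phi psi)
| prv_andE1 G phi psi : prv T G (And phi psi) -> prv T G phi
| prv_andE2 G phi psi : prv T G (And phi psi) -> prv T G psi
| prv_orI1 G phi psi : prv T G phi -> prv T G (Or phi psi)
| prv_orI2 G phi psi : prv T G psi -> prv T G (Or phi psi)
| prv_orE G phi psi chi :
    prv T G (Or phi psi) -> prv T (phi :: G) chi -> prv T (psi :: G) chi ->
    prv T G chi
| prv_impI G phi psi : prv T (phi :: G) psi -> prv T G (Imp phi psi)
| prv_impE G phi psi : prv T G (Imp phi psi) -> prv T G phi -> prv T G psi
| prv_notI G phi psi :
    prv T (phi :: G) psi -> prv T (phi :: G) (Not psi) -> prv T G (Not phi)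
| prv_notE G phi psi : prv T G phi -> prv T G (Not phi) -> prv T G psi
| prv_allI G phi : prv T (map shift G) phi -> prv T G (All phi)
| prv_allE G phi t : prv T G (All phi) -> prv T G (inst t phi)
| prv_exI G phi t : prv T G (inst t phi) -> prv T G (Ex phi)
| prv_exE G phi psi :
    prv T G (Ex phi) -> prv T (phi :: map shift G) (shift psi) -> prv T G psi
| prv_allInI G a phi :
    prv T (Elem 0 a.+1 :: map shift G) phi -> prv T G (AllIn a phi)
| prv_allInE G a phi t :
    prv T G (AllIn a phi) -> prv T G (Elem t a) -> prv T G (inst t phi)
| prv_exInI G a phi t :
    prv T G (Elem t a) -> prv T G (inst t phi) -> prv T G (ExIn a phi)
| prv_exInE G a phi psi :
    prv T G (ExIn a phi) ->
    prv T (phi :: Elem 0 a.+1 :: map shift G) (shift psi) -> prv T G psi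
| prv_eqRefl G x : prv T G (Eql x x)
| prv_eqSubst G x y phi :
    prv T G (Eql x y) -> prv T G (inst x phi) -> prv T G (inst y phi).

(** * Set-theoretic vocabulary *)

Open Scope form_scope.

Definition isEmpty (x : nat) : form := AllIn x (¬ (0 ≐ 0)).

Definition isOne (x : nat) : form := ExIn x (isEmpty 0) ∧ AllIn x (isEmpty 0).

Definition isSubset (x y : nat) : form := AllIn x (0 ∈ y.+1).

(* x = y ∪ {y} *)
Definition isSucc (x y : nat) : form :=
  isSubset y x ∧ y ∈ x ∧ AllIn x (0 ∈ y.+1 ∨ 0 ≐ y.+1).

(* z = {x, y} *)
Definition isUPair (z x y : nat) : form :=
  x ∈ z ∧ y ∈ z ∧ AllIn z (0 ≐ x.+1 ∨ 0 ≐ y.+1).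

(* z = ⟨x, y⟩ = {{x}, {x, y}} *)
Definition isPair (z x y : nat) : form :=
  ExIn z (ExIn z.+1
    (isUPair 1 x.+2 x.+2 ∧ isUPair 0 x.+2 y.+2 ∧ isUPair z.+2 1 0)).

(* t = ⟨⟨x, y⟩, z⟩; the inner pair q satisfies q ∈ {q} ∈ t *)
Definition isTriple (t x y z : nat) : form :=
  ExIn t (ExIn 0 (isPair 0 x.+2 y.+2 ∧ isPair t.+2 0 z.+2)).

(* ⟨x, y⟩ ∈ a *)
Definition pairIn (x y a : nat) : form := ExIn a (isPair 0 x.+1 y.+1).

(* ⟨⟨x, y⟩, z⟩ ∈ a *)
Definition tripleIn (x y z a : nat) : form :=
  ExIn a (isTriple 0 x.+1 y.+1 z.+1).

Definition isTransitive (x : nat) : form := AllIn x (isSubset 0 x.+1).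

Definition isOrd (x : nat) : form :=
  isTransitive x ∧ AllIn x (isTransitive 0).

(** * CZF *)

(* In the schemes, the variables of [phi] not displayed are parameters; the
   renamings skip the auxiliary variables of the scheme, so that these are not
   free in [phi]. *)

Definition ax_extensionality : form :=
  All (All (All (0 ∈ 2 ↔ 0 ∈ 1) → 1 ≐ 0)).

Definition ax_pairing : form :=
  All (All (Ex (All (0 ∈ 1 ↔ 0 ≐ 3 ∨ 0 ≐ 2)))).

Definition ax_union : form :=
  All (Ex (All (0 ∈ 1 ↔ ExIn 2 (1 ∈ 0)))).

Definition ax_infinity : form :=
  Ex (All (0 ∈ 1 ↔ isEmpty 0 ∨ ExIn 1 (isSucc 1 0))).

(* phi(0) *)
Definition ax_induction (phi : form) : form :=
  All (AllIn 0 (ren (scons 0 (fun n => n.+2)) phi) → phi) → All phi.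

(* phi(0); under the quantifiers: a = 2, b = 1, x = 0 *)
Definition ax_separation (phi : form) : form :=
  All (Ex (All (0 ∈ 1 ↔
    0 ∈ 2 ∧ ren (scons 0 (fun n => n.+3)) phi))).

(* phi(x, y) with x = 1, y = 0 *)
Definition ax_strong_collection (phi : form) : form :=
  All (AllIn 0 (Ex (ren (scons 0 (scons 1 (fun n => n.+3))) phi)) →
    Ex (AllIn 1 (ExIn 1
          (ren (scons 0 (scons 1 (fun n => n.+4))) phi))
      ∧ AllIn 0 (ExIn 2
          (ren (scons 1 (scons 0 (fun n => n.+4))) phi)))).

(* phi(x, y, u) with x = 2, y = 1, u = 0; outermost quantifiers:
   ∀a ∀b ∃c ∀u, so that a = 3, b = 2, c = 1, u = 0 *)
Definition ax_subset_collection (phi : form) : form :=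
  All (All (Ex (All (
    AllIn 3 (ExIn 3
      (ren (scons 2 (scons 0 (scons 1 (fun n => n.+4.+2)))) phi)) →
    ExIn 1
      (AllIn 4 (ExIn 1
         (ren (scons 3 (scons 0 (scons 1 (fun n => n.+4.+3)))) phi))
       ∧ AllIn 0 (ExIn 5
         (ren (scons 3 (scons 1 (scons 0 (fun n => n.+4.+3)))) phi))))))).

Inductive CZF : form -> Prop :=
| CZF_extensionality : CZF ax_extensionality
| CZF_pairing : CZF ax_pairing
| CZF_union : CZF ax_union
| CZF_infinity : CZF ax_infinity
| CZF_induction phi : CZF (ax_induction phi)
| CZF_separation phi : Delta0 phi -> CZF (ax_separation phi)
| CZF_strong_collection phi : CZF (ax_strong_collection phi)
| CZF_subset_collection phi : CZF (ax_subset_collection phi).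

(** * WDec(1) and ADCom *)

(* b ⊆ 1 and ∀x ∈ 1 (x ∉ b or ¬¬ x ∈ b) *)
Definition inWDec1 (b : nat) : form :=
  Ex (isOne 0 ∧ isSubset b.+1 0 ∧ AllIn 0 (¬ (0 ∈ b.+2) ∨ ¬ ¬ (0 ∈ b.+2))).

Definition WDec1_not_a_set : form := ¬ Ex (All (0 ∈ 1 ↔ inWDec1 0)).

Definition ADCom : form :=
  All (Ex (All (¬ ¬ (0 ∈ 2) → 0 ∈ 1)) → Ex (isOne 0 ∧ isSubset 1 0)).

(** * Partial combinatory algebras *)

(* The variables denoting the carrier, the graph of application (a set of
   triples ⟨⟨e, f⟩, v⟩ with e f = v), the pairing combinator, the two
   projections and the first two numerals. *)
Record pcaVars : Type := PcaVars {
  car : nat; graph : nat;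
  pr : nat; pr0 : nat; pr1 : nat;
  num0 : nat; num1 : nat }.

(* The same variables under [n] more binders. *)
Definition liftA (n : nat) (A : pcaVars) : pcaVars :=
  PcaVars (n + car A) (n + graph A) (n + pr A) (n + pr0 A) (n + pr1 A)
          (n + num0 A) (n + num1 A).

(* e f = v *)
Definition appl (A : pcaVars) (e f v : nat) : form := tripleIn e f v (graph A).

(* e f is defined and phi(e f); in [phi], the value is variable 0 *)
Definition withApp (A : pcaVars) (e f : nat) (phi : form) : form :=
  ExIn (car A) (appl (liftA 1 A) e.+1 f.+1 0 ∧ phi).

(* Application is a partial binary operation on the carrier. *)
Definition isPartialOp (A : pcaVars) : form :=
  AllIn (graph A)
    (ExIn (car A).+1 (ExIn (car A).+2 (ExIn (car A).+3 (isTriple 3 2 1 0))))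
  ∧ AllIn (car A) (AllIn (car A).+1 (AllIn (car A).+2 (AllIn (car A).+3
      (appl (liftA 4 A) 3 2 1 ∧ appl (liftA 4 A) 3 2 0 → 1 ≐ 0)))).

(* k a b = a *)
Definition isK (A : pcaVars) (k : nat) : form :=
  AllIn (car A) (AllIn (car A).+1
    (withApp (liftA 2 A) k.+2 1 (appl (liftA 3 A) 0 1 2))).

(* s a b is defined, and s a b c ≃ a c (b c);
   in the last lines, a = 5, b = 4, s a b = 2, c = 1, r = 0 *)
Definition isS (A : pcaVars) (s : nat) : form :=
  AllIn (car A) (AllIn (car A).+1
    (withApp (liftA 2 A) s.+2 1 (withApp (liftA 3 A) 0 1
      (AllIn (car A).+4 (AllIn (car A).+4.+1
        (appl (liftA 6 A) 2 1 0 ↔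
         withApp (liftA 6 A) 5 1 (withApp (liftA 7 A) 5 2
           (appl (liftA 8 A) 1 0 2)))))))).

(* p a b is defined, (p a b)_0 = a and (p a b)_1 = b;
   under the quantifiers, a = 3, b = 2, p a b = 0 *)
Definition isPairing (A : pcaVars) : form :=
  AllIn (car A) (AllIn (car A).+1
    (withApp (liftA 2 A) (pr A).+2 1 (withApp (liftA 3 A) 0 1
      (appl (liftA 4 A) (pr0 A).+4 0 3 ∧ appl (liftA 4 A) (pr1 A).+4 0 2)))).

(* d 0 a b = a and d 1 a b = b *)
Definition isCases (A : pcaVars) (d : nat) : form :=
  AllIn (car A) (AllIn (car A).+1
    (withApp (liftA 2 A) d.+2 (num0 A).+2
       (withApp (liftA 3 A) 0 2 (appl (liftA 4 A) 0 2 3))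
     ∧ withApp (liftA 2 A) d.+2 (num1 A).+2
       (withApp (liftA 3 A) 0 2 (appl (liftA 4 A) 0 2 2)))).

(* Nothing is assumed about how p, the projections and the numerals are built
   from k and s: any pairing with its projections is allowed, and any two
   elements 0, 1 for which definition by cases is possible. *)
Definition isPCA (A : pcaVars) : form :=
  isPartialOp A
  ∧ ExIn (car A) (isK (liftA 1 A) 0)
  ∧ ExIn (car A) (isS (liftA 1 A) 0)
  ∧ pr A ∈ car A ∧ pr0 A ∈ car A ∧ pr1 A ∈ car A ∧ isPairing A
  ∧ num0 A ∈ car A ∧ num1 A ∈ car A ∧ ExIn (car A) (isCases (liftA 1 A) 0).

(* phi(v) for v the first (second) projection of e, which must be defined *)
Definition withFst (A : pcaVars) (e : nat) (phi : form) : form :=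
  withApp A (pr0 A) e phi.
Definition withSnd (A : pcaVars) (e : nat) (phi : form) : form :=
  withApp A (pr1 A) e phi.

(** * The realizability universe V(A) *)

(* The recursion V(A)_α = ⋃_{β ∈ α} P(A × V(A)_β) defines a relation between
   ordinals and sets by a positive clause.  As the V(A)_α are proper classes,
   it is expressed as usual in CZF: ⟨α, x⟩ satisfies the relation iff it lies
   in a set g of pairs each of which satisfies the clause with g in place of
   the relation.  By ∈-induction this is the only solution of the recursion. *)

(* for all ⟨β, y⟩ ∈ g there is γ ∈ β such that every w ∈ y is ⟨a, c⟩ with
   a ∈ A and ⟨γ, c⟩ ∈ g; innermost: β = 5, y = 4, γ = 3, w = 2, a = 1, c = 0 *)
Definition stageClosed (A : pcaVars) (g : nat) : form :=
  All (All (pairIn 1 0 g.+2 →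
    ExIn 1 (AllIn 1 (ExIn (car A).+4 (Ex
      (isPair 2 1 0 ∧ pairIn 3 0 g.+4.+2)))))).

(* x ∈ V(A)_α *)
Definition inStage (A : pcaVars) (alpha x : nat) : form :=
  Ex (stageClosed (liftA 1 A) 0 ∧ pairIn alpha.+1 x.+1 0).

(* x ∈ V(A) *)
Definition inV (A : pcaVars) (x : nat) : form :=
  Ex (isOrd 0 ∧ inStage (liftA 1 A) 0 x.+1).

(** * Realizability *)

(* The recursive definition of e ⊩ a = b is expressed in the same way, by sets
   g of triples ⟨⟨e, a⟩, b⟩ each of which satisfies the recursion clause with
   g in place of the relation. *)

(* there is c with ⟨(v)_0, c⟩ ∈ b and ⟨⟨(v)_1, d⟩, c⟩ ∈ g;
   innermost: (v)_0 = 2, (v)_1 = 1, c = 0 *)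
Definition rMemIn (A : pcaVars) (g v d b : nat) : form :=
  withFst A v (withSnd (liftA 1 A) v.+1
    (Ex (pairIn 2 0 b.+3 ∧ tripleIn 1 d.+3 0 g.+3))).

(* for all f, d: ⟨f, d⟩ ∈ a implies that (e)_0 f realizes d ∈ b according to g,
   and ⟨f, d⟩ ∈ b implies that (e)_1 f realizes d ∈ a according to g;
   innermost: f = 3, d = 2, value of the application = 0 *)
Definition rEqlClause (A : pcaVars) (g e a b : nat) : form :=
  All (All
    ((pairIn 1 0 a.+2 →
        withFst (liftA 2 A) e.+2 (withApp (liftA 3 A) 0 2
          (rMemIn (liftA 4 A) g.+4 0 2 b.+4)))
     ∧ (pairIn 1 0 b.+2 →
        withSnd (liftA 2 A) e.+2 (withApp (liftA 3 A) 0 2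
          (rMemIn (liftA 4 A) g.+4 0 2 a.+4))))).

Definition rEqlClosed (A : pcaVars) (g : nat) : form :=
  All (All (All (tripleIn 2 1 0 g.+3 → rEqlClause (liftA 3 A) g.+3 2 1 0))).

(* e ⊩ a = b *)
Definition rEql (A : pcaVars) (e a b : nat) : form :=
  Ex (rEqlClosed (liftA 1 A) 0 ∧ tripleIn e.+1 a.+1 b.+1 0).

(* e ⊩ a ∈ b *)
Definition rMem (A : pcaVars) (e a b : nat) : form :=
  withFst A e (withSnd (liftA 1 A) e.+1
    (Ex (pairIn 2 0 b.+3 ∧ rEql (liftA 3 A) 1 a.+3 0))).

(* [rho] lifted to [n] more binders *)
Definition liftv (n : nat) (rho : nat -> nat) : nat -> nat :=
  fun x => n + rho x.

(* [rlz A e rho phi] is e ⊩ phi, the variable x of [phi] standing for the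
   element rho x of V(A). *)
Fixpoint rlz (A : pcaVars) (e : nat) (rho : nat -> nat) (phi : form) : form :=
  match phi with
  | Elem x y => rMem A e (rho x) (rho y)
  | Eql x y => rEql A e (rho x) (rho y)
  | And phi psi =>
      withFst A e (rlz (liftA 1 A) 0 (liftv 1 rho) phi)
      ∧ withSnd A e (rlz (liftA 1 A) 0 (liftv 1 rho) psi)
  | Or phi psi =>
      (appl A (pr0 A) e (num0 A)
         ∧ withSnd A e (rlz (liftA 1 A) 0 (liftv 1 rho) phi))
      ∨ (appl A (pr0 A) e (num1 A)
         ∧ withSnd A e (rlz (liftA 1 A) 0 (liftv 1 rho) psi))
  | Imp phi psi =>
      AllIn (car A) (rlz (liftA 1 A) 0 (liftv 1 rho) phi →
        withApp (liftA 1 A) e.+1 0 (rlz (liftA 2 A) 0 (liftv 2 rho) psi))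
  | Not phi => ¬ ExIn (car A) (rlz (liftA 1 A) 0 (liftv 1 rho) phi)
  | AllIn a phi => (* f = 1, c = 0, then e f = 0, c = 1 *)
      All (All (pairIn 1 0 (rho a).+2 →
        withApp (liftA 2 A) e.+2 1
          (rlz (liftA 3 A) 0 (scons 1 (liftv 3 rho)) phi)))
  | ExIn a phi => (* (e)_0 = 2, (e)_1 = 1, c = 0 *)
      withFst A e (withSnd (liftA 1 A) e.+1
        (Ex (pairIn 2 0 (rho a).+3
           ∧ rlz (liftA 3 A) 1 (scons 0 (liftv 3 rho)) phi)))
  | All phi =>
      All (inV (liftA 1 A) 0 →
        rlz (liftA 1 A) e.+1 (scons 0 (liftv 1 rho)) phi)
  | Ex phi =>
      Ex (inV (liftA 1 A) 0
        ∧ rlz (liftA 1 A) e.+1 (scons 0 (liftv 1 rho)) phi)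
  end.

(* V(A) ⊨ phi, for a sentence phi *)
Definition models (A : pcaVars) (phi : form) : form :=
  ExIn (car A) (rlz (liftA 1 A) 0 (liftv 1 id) phi).

Close Scope form_scope.

(* Main.v *)
Require Import Defs.
From mathcomp Require Import all_boot.
From Stdlib Require List.

(** The realizability universe is used only through names of truth values.  Given
    a set c of pairs which is not empty, a truth value b is coded by the name
    {w ∈ c | 0 ∈ b}, and decoded by asking whether a name has a pair as an element.
    A realizer of an equation between names maps pairs to pairs ([rEql_hasPair]),
    so the decoded value depends only on what a name denotes in V(A).  For every
    set y, strong collection gives in V a set W of the truth values decoded from
    the names in y ([decodes_ex]); if a name of b is realized to belong to y, then
    b ∈ W ([decode]).

    Suppose f realizes that y is the set WDec(1).  Each b ∈ WDec(1), coded with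
    c = {⟨0, ∅⟩}, is realized to be weakly decidable ([inWDec1_realized]): the
    statement is a disjunction of negations, whose realizers carry no information
    except which disjunct is meant.  So f yields membership of the name in y,
    WDec(1) is contained in the set W, and it is a set by Δ₀-separation.

    For ADCom one realizer of x ⊆ 1 works uniformly, once the names c of elements
    of x are known to be without pairs ([ADCom_realized]).  If c had a pair, it
    could be used to code truth values: ¬¬(p = 1) makes the name of p not not equal
    to c, hence not not a member of x, and so, by the assumed bound on the double
    complement of x, a member of a set y.  Then W bounds the double complement of
    {1}, and ADCom in V gives {1} ⊆ 1.  This argument needs one realizer of c = c
    for all c in V(A), which comes from a fixed point in the pca
    ([idRealizer_ex], [rEql_refl]).

    The theorem asserts derivability in a formal system.  The derivations are built
    from rules that treat the context as a Kripke world ([imp_intro], [ex_elim] and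
    the like), whose quantifier rules rest on the existence of fresh variables
    ([prv_generic]); facts are then ordinary hypotheses [G ⊢ phi] about variables
    of type [nat]. *)

Set Implicit Arguments.
Unset Strict Implicit.
Unset Printing Implicit Defensive.

(** * Renaming of variables *)

(** Only the variables below [bound phi] can be free in [phi]; a variable at
    or above the bounds of all formulas of a sequent is therefore fresh. *)
Fixpoint bound (phi : form) : nat :=
  match phi with
  | Elem x y | Eql x y => maxn x.+1 y.+1
  | And phi psi | Or phi psi | Imp phi psi => maxn (bound phi) (bound psi)
  | Not phi => bound phi
  | AllIn a phi | ExIn a phi => maxn a.+1 (bound phi).-1
  | All phi | Ex phi => (bound phi).-1
  end.

Lemma up_agree n r r' :
  (forall x, x < n.-1 -> r x = r' x) -> forall x, x < n -> up r x = up r' x.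
Proof. by case: n => // n eq_r [//|x] /= lt_xn; rewrite /up /= eq_r. Qed.

Lemma ren_agree phi r r' :
  (forall x, x < bound phi -> r x = r' x) -> ren r phi = ren r' phi.
Proof.
elim: phi r r' => /=
  [x y|x y|f IHf g IHg|f IHf g IHg|f IHf g IHg|f IHf|a f IHf|a f IHf|f IHf|f IHf]
  r r' eq_r;
  first [ by rewrite !eq_r ?leq_max ?leqnn ?orbT
        | by rewrite (IHf r r') ?(IHg r r') // => x lt_x; rewrite eq_r // leq_max lt_x ?orbT
        | idtac ].
- by rewrite eq_r ?leq_max ?leqnn // (IHf _ (up r')) //;
    apply: up_agree => x lt_x; rewrite eq_r // leq_max lt_x orbT.
- by rewrite eq_r ?leq_max ?leqnn // (IHf _ (up r')) //;
    apply: up_agree => x lt_x; rewrite eq_r // leq_max lt_x orbT.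
- by rewrite (IHf _ (up r')) //; apply: up_agree.
- by rewrite (IHf _ (up r')) //; apply: up_agree.
Qed.

Lemma ren_ext r r' phi : r =1 r' -> ren r phi = ren r' phi.
Proof. by move=> eq_r; apply: ren_agree. Qed.

Lemma up_comp r r' : up r \o up r' =1 up (r \o r').
Proof. by case. Qed.

Lemma ren_comp r r' phi : ren r (ren r' phi) = ren (r \o r') phi.
Proof.
elim: phi r r' => /=
  [//|//|f IHf g IHg|f IHf g IHg|f IHf g IHg|f IHf|a f IHf|a f IHf|f IHf|f IHf] r r';
  by rewrite !IHf ?IHg // (ren_ext _ (up_comp r r')).
Qed.

Lemma ren_id r phi : (forall x, x < bound phi -> r x = x) -> ren r phi = phi.
Proof.
move=> eq_r; rewrite (ren_agree (r' := id)) //.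
elim: phi {eq_r} => //=
  [f IHf g IHg|f IHf g IHg|f IHf g IHg|f IHf|a f IHf|a f IHf|f IHf|f IHf];
  rewrite ?(@ren_ext (up id) id) ?IHf ?IHg //; by case.
Qed.

Lemma ren_shift r phi : ren (up r) (shift phi) = shift (ren r phi).
Proof. by rewrite /shift !ren_comp. Qed.

Lemma ren_inst r t phi : ren r (inst t phi) = inst (r t) (ren (up r) phi).
Proof. by rewrite /inst !ren_comp; apply: ren_ext; case. Qed.

Lemma inst_shift t phi : inst t (shift phi) = phi.
Proof. by rewrite /inst /shift ren_comp ren_id. Qed.

Lemma Delta0_ren r phi : Delta0 (ren r phi) = Delta0 phi.
Proof. by elim: phi r => //= f IHf g IHg r; rewrite IHf IHg. Qed.

(** * Weakening, renaming and fresh variables in derivations *)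

Definition ren_closed (T : form -> Prop) :=
  forall r phi, T phi -> T (ren r phi).

(* Reduces an equation between formulas to equations between renamings of the
   scheme variable. *)
Ltac peel :=
  repeat match goal with
  | |- ren _ _ = ren _ _ => fail 1
  | |- _ = _ :> form => f_equal
  end.

(** The schemes are stated with their parameters free, and renaming the
    parameters of an instance gives another instance. *)
Lemma CZF_ren_closed : ren_closed CZF.
Proof.
have cast a b : a = b -> CZF a -> CZF b by move->.
move=> r phi; case=> {phi}.
- exact: CZF_extensionality.
- exact: CZF_pairing.
- exact: CZF_union.
- exact: CZF_infinity.
- move=> phi; apply: cast (CZF_induction (ren (up r) phi)).
  rewrite /ax_induction /= !ren_comp.
  by peel; apply: ren_ext; case.
- move=> phi; rewrite -(Delta0_ren (up r)) => /CZF_separation; apply: cast.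
  rewrite /ax_separation /= !ren_comp.
  by peel; apply: ren_ext; case.
- move=> phi; apply: cast (CZF_strong_collection (ren (up (up r)) phi)).
  rewrite /ax_strong_collection /= !ren_comp.
  by peel; apply: ren_ext; do 2?case.
- move=> phi; apply: cast (CZF_subset_collection (ren (up (up (up r))) phi)).
  rewrite /ax_subset_collection /= !ren_comp.
  by peel; apply: ren_ext; do 3?case.
Qed.

Lemma mem_map (f : form -> form) G phi :
  List.In phi G -> List.In (f phi) (map f G).
Proof. by elim: G => //= psi G IHG [->|/IHG]; [left|right]. Qed.

Lemma incl_map (f : form -> form) G G' :
  List.incl G G' -> List.incl (map f G) (map f G').
Proof.
move=> sGG' phi; elim: G sGG' => //= psi G IHG sGG' [<-|].
  by apply: mem_map; apply: sGG'; left.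
by apply: IHG => chi chiG; apply: sGG'; right.
Qed.

Lemma incl_cons (phi : form) G G' :
  List.incl G G' -> List.incl (phi :: G) (phi :: G').
Proof. by move=> sGG' psi [->|/sGG']; [left|right]. Qed.

Lemma prv_weaken T G G' phi : List.incl G G' -> prv T G phi -> prv T G' phi.
Proof.
move=> sGG' H; elim: H G' sGG' => {G phi}
 [G f Tf|G f Gf|G f g _ IHf _ IHg|G f g _ IH|G f g _ IH|G f g _ IH|G f g _ IH
 |G f g h _ IH _ IHf _ IHg|G f g _ IH|G f g _ IH _ IHf|G f g _ IH _ IHn
 |G f g _ IH _ IHn|G f _ IH|G f t _ IH|G f t _ IH|G f g _ IH _ IHg
 |G a f _ IH|G a f t _ IH _ IHa|G a f t _ IHa _ IH|G a f g _ IH _ IHg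
 |G x|G x y f _ IHe _ IH] G' sGG'.
- exact: prv_ax.
- by apply: prv_hyp; apply: sGG'.
- by apply: prv_andI; [apply: IHf|apply: IHg].
- by apply: prv_andE1; apply: IH.
- by apply: prv_andE2; apply: IH.
- by apply: prv_orI1; apply: IH.
- by apply: prv_orI2; apply: IH.
- by apply: prv_orE (IH _ sGG') _ _; [apply: IHf|apply: IHg]; apply: incl_cons.
- by apply: prv_impI; apply: IH; apply: incl_cons.
- exact: prv_impE (IH _ sGG') (IHf _ sGG').
- by apply: (prv_notI (psi := g)); [apply: IH|apply: IHn]; apply: incl_cons.
- exact: prv_notE (IH _ sGG') (IHn _ sGG').
- by apply: prv_allI; apply: IH; apply: incl_map.
- exact: prv_allE (IH _ sGG').
- exact: prv_exI (IH _ sGG').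
- apply: prv_exE (IH _ sGG') _; apply: IHg; apply: incl_cons; exact: incl_map.
- by apply: prv_allInI; apply: IH; apply: incl_cons; apply: incl_map.
- exact: prv_allInE (IH _ sGG') (IHa _ sGG').
- exact: prv_exInI (IHa _ sGG') (IH _ sGG').
- apply: prv_exInE (IH _ sGG') _; apply: IHg; do 2!apply: incl_cons; exact: incl_map.
- exact: prv_eqRefl.
- exact: prv_eqSubst (IHe _ sGG') (IH _ sGG').
Qed.

Lemma map_ren_shift r G : map (ren (up r)) (map shift G) = map shift (map (ren r) G).
Proof. by elim: G => //= phi G ->; rewrite ren_shift. Qed.

Lemma prv_ren T (T_ren : ren_closed T) r G phi :
  prv T G phi -> prv T (map (ren r) G) (ren r phi).
Proof.
move=> H; elim: H r => {G phi} /=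
 [G f Tf|G f Gf|G f g _ IHf _ IHg|G f g _ IH|G f g _ IH|G f g _ IH|G f g _ IH
 |G f g h _ IH _ IHf _ IHg|G f g _ IH|G f g _ IH _ IHf|G f g _ IH _ IHn
 |G f g _ IH _ IHn|G f _ IH|G f t _ IH|G f t _ IH|G f g _ IH _ IHg
 |G a f _ IH|G a f t _ IH _ IHa|G a f t _ IHa _ IH|G a f g _ IH _ IHg
 |G x|G x y f _ IHe _ IH] r.
- by apply: prv_ax; apply: T_ren.
- by apply: prv_hyp; apply: mem_map.
- exact: prv_andI (IHf r) (IHg r).
- exact: prv_andE1 (IH r).
- exact: prv_andE2 (IH r).
- exact: prv_orI1 (IH r).
- exact: prv_orI2 (IH r).
- exact: prv_orE (IH r) (IHf r) (IHg r).
- exact: prv_impI (IH r).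
- exact: prv_impE (IH r) (IHf r).
- exact: prv_notI (IH r) (IHn r).
- exact: prv_notE (IH r) (IHn r).
- by apply: prv_allI; rewrite -map_ren_shift.
- by rewrite ren_inst; apply: prv_allE (IH r).
- by apply: (prv_exI (t := r t)); rewrite -ren_inst.
- by apply: prv_exE (IH r) _; rewrite -map_ren_shift -ren_shift.
- by apply: prv_allInI; rewrite -map_ren_shift; apply: IH.
- by rewrite ren_inst; apply: prv_allInE (IH r) (IHa r).
- by apply: (prv_exInI (t := r t)) (IHa r) _; rewrite -ren_inst.
- by apply: prv_exInE (IH r) _; rewrite -map_ren_shift -ren_shift; apply: IHg.
- exact: prv_eqRefl.
- have := IH r; rewrite !ren_inst; exact: prv_eqSubst (IHe r).
Qed.

(** Eigenvariables as metavariables: it suffices to derive all instances,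
    because the instance at a variable [t] that is not free in the sequent is
    turned into the sequent itself by the renaming that sends [t] back to 0. *)
Lemma prv_generic T (T_ren : ren_closed T) G phi :
  (forall t, prv T (map (inst t) G) (inst t phi)) -> prv T G phi.
Proof.
move=> H; pose t := \max_(psi <- phi :: G) bound psi.
pose r n := if n == t then 0 else n.+1.
have rK psi : bound psi <= t -> ren r (inst t psi) = psi.
  move=> le_psi; rewrite /inst ren_comp; apply: ren_id; case=> [|n] lt_n /=.
    by rewrite /r eqxx.
  by rewrite /r ltn_eqF // (leq_trans _ le_psi) // ltnW.
have [le_phi le_G] : bound phi <= t /\ \max_(psi <- G) bound psi <= t.
  by rewrite /t big_cons leq_maxl leq_maxr.
have := prv_ren T_ren r (H t); rewrite rK //.
suff -> : map (ren r) (map (inst t) G) = G by [].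
have: forall psi, List.In psi G -> bound psi <= t.
  elim: (G) le_G => //= psi G' IHG; rewrite big_cons geq_max => /andP[le_psi le_G'].
  by move=> chi [<-|/IHG]; [|apply].
elim: (G) => //= psi G' IHG le_t; rewrite rK ?IHG //; last by apply: le_t; left.
by move=> chi chiG; apply: le_t; right.
Qed.

(** * Natural deduction in Kripke style *)

Notation "G ⊢ phi" := (prv CZF G phi%F)
  (at level 97, phi at level 96, no associativity).
Notation "G ⊑ H" := (List.incl G H) (at level 70, no associativity).

Lemma incl_consr (phi : form) G : G ⊑ phi :: G.
Proof. by move=> psi; right. Qed.

Lemma hyp0 G phi : phi :: G ⊢ phi.
Proof. by apply: prv_hyp; left. Qed.

Lemma map_inst_shift t G : map (inst t) (map shift G) = G.
Proof. by elim: G => //= phi G ->; rewrite inst_shift. Qed.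

Lemma and_elim G phi psi : G ⊢ phi ∧ psi -> (G ⊢ phi) /\ (G ⊢ psi).
Proof. by move=> H; split; [apply: prv_andE1 H|apply: prv_andE2 H]. Qed.

Lemma iff_mp G phi psi : G ⊢ phi ↔ psi -> G ⊢ phi -> G ⊢ psi.
Proof. by move/prv_andE1; apply: prv_impE. Qed.

Lemma iff_mpr G phi psi : G ⊢ phi ↔ psi -> G ⊢ psi -> G ⊢ phi.
Proof. by move/prv_andE2; apply: prv_impE. Qed.

(** From here on a context is treated as a world that may grow: what is assumed
    during a proof is derivable in some larger context [G'], and earlier facts
    are carried over by weakening.  Quantifiers are opened with metavariables of
    type [nat]. *)
Lemma imp_intro G phi psi :
  (forall G', G ⊑ G' -> G' ⊢ phi -> G' ⊢ psi) -> G ⊢ phi → psi.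
Proof. by move=> H; apply: prv_impI; apply: H (hyp0 _ _); apply: incl_consr. Qed.

Lemma not_elim G phi psi : G ⊢ ¬ phi -> G ⊢ phi -> G ⊢ psi.
Proof. by move=> H Hphi; apply: prv_notE Hphi H. Qed.
Arguments not_elim {G phi psi}.

Definition absurd : form := ¬ (0 ≐ 0).

Lemma absurd_elim G phi : G ⊢ absurd -> G ⊢ phi.
Proof. by move=> H; apply: not_elim H (prv_eqRefl _ _ _). Qed.
Arguments absurd_elim {G phi}.

Lemma not_intro G phi :
  (forall G', G ⊑ G' -> G' ⊢ phi -> G' ⊢ absurd) -> G ⊢ ¬ phi.
Proof.
move=> H; apply: (prv_notI (psi := 0 ≐ 0)); first exact: prv_eqRefl.
by apply: H (hyp0 _ _); apply: incl_consr.
Qed.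

Lemma or_elim G phi psi chi :
  G ⊢ phi ∨ psi ->
  (forall G', G ⊑ G' -> G' ⊢ phi -> G' ⊢ chi) ->
  (forall G', G ⊑ G' -> G' ⊢ psi -> G' ⊢ chi) -> G ⊢ chi.
Proof.
move=> H H1 H2; apply: prv_orE H _ _.
  by apply: H1 (hyp0 _ _); apply: incl_consr.
by apply: H2 (hyp0 _ _); apply: incl_consr.
Qed.

Lemma all_intro G phi : (forall t, G ⊢ inst t phi) -> G ⊢ All phi.
Proof.
move=> H; apply: prv_allI; apply: (prv_generic CZF_ren_closed) => t.
by rewrite map_inst_shift.
Qed.

Lemma all_elim t G phi : G ⊢ All phi -> G ⊢ inst t phi.
Proof. exact: prv_allE. Qed.

Lemma ex_intro t G phi : G ⊢ inst t phi -> G ⊢ Ex phi.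
Proof. exact: prv_exI. Qed.

Lemma ex_elim G phi chi :
  G ⊢ Ex phi -> (forall t G', G ⊑ G' -> G' ⊢ inst t phi -> G' ⊢ chi) ->
  G ⊢ chi.
Proof.
move=> Hex H; apply: prv_exE Hex _; apply: (prv_generic CZF_ren_closed) => t /=.
by rewrite map_inst_shift inst_shift; apply: H (hyp0 _ _); apply: incl_consr.
Qed.

Lemma allIn_intro G a phi :
  (forall t G', G ⊑ G' -> G' ⊢ t ∈ a -> G' ⊢ inst t phi) -> G ⊢ AllIn a phi.
Proof.
move=> H; apply: prv_allInI; apply: (prv_generic CZF_ren_closed) => t /=.
by rewrite map_inst_shift; apply: H (hyp0 _ _); apply: incl_consr.
Qed.

Lemma allIn_elim t G a phi : G ⊢ AllIn a phi -> G ⊢ t ∈ a -> G ⊢ inst t phi.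
Proof. exact: prv_allInE. Qed.

Lemma exIn_intro t G a phi : G ⊢ t ∈ a -> G ⊢ inst t phi -> G ⊢ ExIn a phi.
Proof. exact: prv_exInI. Qed.

Lemma exIn_elim G a phi chi :
  G ⊢ ExIn a phi ->
  (forall t G', G ⊑ G' -> G' ⊢ t ∈ a -> G' ⊢ inst t phi -> G' ⊢ chi) ->
  G ⊢ chi.
Proof.
move=> Hex H; apply: prv_exInE Hex _; apply: (prv_generic CZF_ren_closed) => t /=.
rewrite map_inst_shift inst_shift; apply: H (hyp0 _ _).
  by move=> psi ?; right; right.
by apply: prv_hyp; right; left.
Qed.

Lemma eql_refl {G x} : G ⊢ x ≐ x.
Proof. exact: prv_eqRefl. Qed.

Lemma eql_elim G x y phi :
  G ⊢ x ≐ y -> G ⊢ inst x phi -> G ⊢ inst y phi.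
Proof. exact: prv_eqSubst. Qed.

Lemma eql_sym G x y : G ⊢ x ≐ y -> G ⊢ y ≐ x.
Proof. by move=> E; apply: (eql_elim (phi := 0 ≐ x.+1) E); exact: eql_refl. Qed.

Lemma eql_trans G x y z : G ⊢ x ≐ y -> G ⊢ y ≐ z -> G ⊢ x ≐ z.
Proof. by move=> Exy Eyz; apply: (eql_elim (phi := x.+1 ≐ 0) Eyz). Qed.

(** The macros of the object language commute with renaming by computation.
    Such equations are registered as rewrite rules, so that an instantiated
    formula is displayed again in terms of the macros. *)
Lemma ren_pairIn r x y a : ren r (pairIn x y a) = pairIn (r x) (r y) (r a).
Proof. by []. Qed.

Hint Rewrite ren_pairIn : renaming.

Ltac normal H :=
  unfold inst, shift in H; cbn [ren scons up] in H;
  autorewrite with renaming in H;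
  cbn [scons up liftA car graph pr pr0 pr1 num0 num1] in H;
  rewrite ?addSn ?add0n in H; cbn [scons up] in H.

Ltac normal_goal :=
  unfold inst, shift; cbn [ren scons up];
  autorewrite with renaming;
  cbn [scons up liftA car graph pr pr0 pr1 num0 num1];
  rewrite ?addSn ?add0n; cbn [scons up].

(* Carries the derivable facts of the proof context over to a larger context,
   which takes the place of the previous one. *)
Ltac weaken_hyps s :=
  match type of s with List.incl ?G ?G' =>
    repeat match goal with
    | H : prv _ G _ |- _ => apply (prv_weaken s) in H
    end; clear s; try (clear G; rename G' into G)
  end.

Ltac intro_world :=
  let g := fresh "G" in let s := fresh "s" in intros g s; weaken_hyps s.

Ltac fold_inst :=
  lazymatch goal with |- prv _ _ (inst _ _) => normal_goal | _ => idtac end.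

(* A goal without a binder on top is put into macro form again after each
   introduction; implications and bounded quantifiers move to a larger context. *)
Tactic Notation "var" simple_intropattern(x) :=
  apply: all_intro; intros x; fold_inst.
Tactic Notation "assume" simple_intropattern(H) :=
  first [refine (imp_intro _) | refine (not_intro _)];
  intro_world; intros H.
Tactic Notation "var" simple_intropattern(x) "in" ident(H) :=
  refine (allIn_intro _); intros x; intro_world; intros H; fold_inst.

Tactic Notation "obtain" ident(x) ident(H) "from" constr(E) :=
  refine (ex_elim E _); intros x; intro_world; intros H; normal H.
Tactic Notation "obtain" ident(x) ident(H1) ident(H2) "from" constr(E) :=
  refine (exIn_elim E _); intros x; intro_world; intros H1 H2; normal H1; normal H2.
Tactic Notation "cases" ident(H) "from" constr(E) :=
  refine (or_elim E _ _); intro_world; intros H; normal H.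

Tactic Notation "witness" constr(t) :=
  first [refine (ex_intro (t := t) _) | refine (exIn_intro (t := t) _ _)];
  fold_inst.

(* For [P : nat -> form] given by a term, the formula [phi] with [inst x phi]
   convertible to [P x] for every [x]: [P v] is shifted, and the image [S v] of
   the abstracted variable is then replaced by 0.  Full evaluation makes every
   occurrence of [v] visible as [S v] under some further successors. *)
Ltac abstracted_formula P :=
  let f := constr:(fun v : nat => ltac:(
    let F := eval cbv in (ren S (P v)) in
    match (eval pattern (S v) in F) with
    | ?Q _ => let q := eval cbv beta in (Q 0) in exact q
    end)) in
  eval cbv beta in (f 0).

(* Leibniz substitution needs the formula in which a variable is replaced; it is
   found here by abstracting that variable from the goal or the hypothesis. *)
Ltac subst_in E H :=
  lazymatch type of E with prv _ _ (Eql ?x ?y) =>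
    lazymatch type of H with prv _ ?G ?F =>
      match (eval pattern x in F) with ?P _ =>
        let phi := abstracted_formula P in
        let Py := eval cbv beta in (P y) in
        apply (@eql_elim G x y phi E : _ -> prv CZF G Py) in H
      end end end.
Ltac subst_goal E :=
  lazymatch type of E with prv _ _ (Eql ?x ?y) =>
    lazymatch goal with |- prv _ ?G ?F =>
      match (eval pattern x in F) with ?P _ =>
        let phi := abstracted_formula P in
        let Py := eval cbv beta in (P y) in
        refine (@eql_elim G y x phi (eql_sym E) (_ : prv CZF G Py))
      end end end.
Tactic Notation "transport" constr(E) "in" ident(H) :=
  let E' := fresh in pose proof E as E'; normal E'; subst_in E' H; clear E'.
Tactic Notation "transport" constr(E) :=
  let E' := fresh in pose proof E as E'; normal E'; subst_goal E'; clear E'.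
Tactic Notation "transport" "<-" constr(E) "in" ident(H) :=
  let E' := fresh in pose proof (eql_sym E) as E'; normal E'; subst_in E' H;
  clear E'.
Tactic Notation "transport" "<-" constr(E) :=
  let E' := fresh in pose proof (eql_sym E) as E'; normal E'; subst_goal E';
  clear E'.

(** * Sets in CZF *)

(** In the rules below [phi] is used as it stands, with variable 0 for the
    element: the renaming in the axiom is undone by the instantiation. *)
Lemma separation G a phi chi : Delta0 phi ->
  (forall b G', G ⊑ G' -> G' ⊢ All (0 ∈ b.+1 ↔ 0 ∈ a.+1 ∧ phi) -> G' ⊢ chi) ->
  G ⊢ chi.
Proof.
move=> D0 H.
have sep := all_elim a (prv_ax G (CZF_separation D0)).
apply: ex_elim sep _ => b G' s; rewrite /inst /= !ren_comp ren_id; last by case.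
exact: H.
Qed.

Tactic Notation "separate" ident(b) ident(H) "from" constr(a) "by" open_constr(phi) :=
  refine (@separation _ a phi _ isT _); intros b; intro_world; intros H.

Lemma strong_collection G a phi chi : G ⊢ AllIn a (Ex phi) ->
  (forall b G', G ⊑ G' -> G' ⊢ AllIn a (ExIn b.+1 phi) ->
     G' ⊢ AllIn b (ExIn a.+1 (ren (scons 1 (scons 0 (fun n => n.+2))) phi)) ->
     G' ⊢ chi) ->
  G ⊢ chi.
Proof.
move=> tot H.
have coll := all_elim a (prv_ax G (CZF_strong_collection phi)).
move: coll; rewrite /inst /= !ren_comp ren_id; last by do 2?case.
move/prv_impE/(_ tot) => coll; apply: ex_elim coll _ => b G' s.
rewrite /inst /= !ren_comp ren_id; last by do 2?case.
move/and_elim=> [Hl Hr]; apply: H s Hl _.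
by rewrite (ren_ext (r' := scons 1 (scons 0 (fun n => n.+2)))) in Hr; last by do 2?case.
Qed.

Lemma extensionality G a b :
  G ⊢ isSubset a b -> G ⊢ isSubset b a -> G ⊢ a ≐ b.
Proof.
move=> Hab Hba.
apply: (prv_impE (all_elim b (all_elim a (prv_ax G CZF_extensionality)))).
var x; apply: prv_andI; assume H.
  exact: allIn_elim Hab H.
exact: allIn_elim Hba H.
Qed.

Lemma mem_congr G t a b : G ⊢ a ≐ b -> G ⊢ t ∈ a -> G ⊢ t ∈ b.
Proof. by move=> E H; transport E in H. Qed.

Lemma empty_ex G : G ⊢ Ex (isEmpty 0).
Proof.
(* Any set can be separated from: the free variable 0 denotes one. *)
separate b Hb from 0 by (¬ (0 ≐ 0)); witness b; var x in Hx.
by have [_ ?] := and_elim (iff_mp (all_elim x Hb) Hx).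
Qed.

Lemma empty_elim G x t phi : G ⊢ isEmpty x -> G ⊢ t ∈ x -> G ⊢ phi.
Proof. by move=> Hx Ht; apply: not_elim (allIn_elim Hx Ht) eql_refl. Qed.
Arguments empty_elim {G x t phi}.

Lemma empty_unique G x y : G ⊢ isEmpty x -> G ⊢ isEmpty y -> G ⊢ x ≐ y.
Proof.
move=> Hx Hy; apply: extensionality; var t in Ht.
  exact: empty_elim Hx Ht.
exact: empty_elim Hy Ht.
Qed.

(** * Kuratowski pairs *)

Lemma upair_ex G x y : G ⊢ Ex (isUPair 0 x.+1 y.+1).
Proof.
obtain z Hz from (all_elim y (all_elim x (prv_ax G CZF_pairing))).
witness z; apply: prv_andI; last apply: prv_andI.
- exact: iff_mpr (all_elim x Hz) (prv_orI1 _ eql_refl).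
- exact: iff_mpr (all_elim y Hz) (prv_orI2 _ eql_refl).
- by var t in Ht; apply: iff_mp (all_elim t Hz) Ht.
Qed.

Lemma upair_elim G z x y :
  G ⊢ isUPair z x y -> [/\ G ⊢ x ∈ z, G ⊢ y ∈ z &
    forall t, G ⊢ t ∈ z -> G ⊢ t ≐ x ∨ t ≐ y].
Proof.
move=> /and_elim[Hx /and_elim[Hy H]]; split=> // t Ht.
exact: allIn_elim H Ht.
Qed.

Lemma singleton_elim G z x t : G ⊢ isUPair z x x -> G ⊢ t ∈ z -> G ⊢ t ≐ x.
Proof.
by case/upair_elim=> _ _ H /H Ht; cases Et from Ht.
Qed.

Lemma pair_ex G x y : G ⊢ Ex (isPair 0 x.+1 y.+1).
Proof.
obtain u Hu from (upair_ex G x x).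
obtain v Hv from (upair_ex G x y).
obtain z Hz from (upair_ex G u v).
have [uz vz _] := upair_elim Hz.
by witness z; witness u => //; witness v => //; apply: prv_andI => //; apply: prv_andI.
Qed.

Lemma pair_fst G z x y x' y' :
  G ⊢ isPair z x y -> G ⊢ isPair z x' y' -> G ⊢ x ≐ x'.
Proof.
move=> H H'.
obtain u uz H1 from H; obtain v vz H2 from H1.
obtain u' uz' H1' from H'; obtain v' vz' H2' from H1'.
have [Hu _] := and_elim H2.
have [Hu' /and_elim[Hv' Hz']] := and_elim H2'.
have [xu _ _] := upair_elim Hu; have [xu' _ _] := upair_elim Hu'.
have [xv' _ _] := upair_elim Hv'; have [_ _ uv'] := upair_elim Hz'.
cases E from (uv' u uz).
  exact: singleton_elim Hu' (mem_congr E xu).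
exact: eql_sym (singleton_elim Hu (mem_congr (eql_sym E) xv')).
Qed.

(** In place of the classical case distinction on x = y, this disjunction and its
    mirror image are combined in [pair_inj]. *)
Lemma pair_snd_cases G z x y x' y' :
  G ⊢ isPair z x y -> G ⊢ isPair z x' y' -> G ⊢ y ≐ x' ∨ y ≐ y'.
Proof.
move=> H H'.
obtain u uz H1 from H; obtain v vz H2 from H1.
obtain u' uz' H1' from H'; obtain v' vz' H2' from H1'.
have [_ /and_elim[Hv _]] := and_elim H2.
have [Hu' /and_elim[Hv' Hz']] := and_elim H2'.
have [_ yv _] := upair_elim Hv.
have [_ _ uv'] := upair_elim Hz'.
cases E from (uv' v vz).
  exact: prv_orI1 (singleton_elim Hu' (mem_congr E yv)).
by have [_ _] := upair_elim Hv'; apply; apply: mem_congr E yv.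
Qed.

Lemma pair_inj G z x y x' y' :
  G ⊢ isPair z x y -> G ⊢ isPair z x' y' -> (G ⊢ x ≐ x') /\ (G ⊢ y ≐ y').
Proof.
move=> H H'; have Ex := pair_fst H H'; split=> //.
cases E from (pair_snd_cases H H') => //.
cases E' from (pair_snd_cases H' H); last exact: eql_sym.
exact: eql_trans E (eql_trans (eql_sym Ex) (eql_sym E')).
Qed.

Lemma triple_ex G x y z : G ⊢ Ex (isTriple 0 x.+1 y.+1 z.+1).
Proof.
obtain q Hq from (pair_ex G x y); obtain t Ht from (pair_ex G q z).
witness t; obtain u ut H1 from Ht.
obtain v vt H2 from H1; have [/upair_elim[qu _ _] _] := and_elim H2.
by witness u => //; witness q => //; apply: prv_andI.
Qed.

Lemma triple_inj G t x y z x' y' z' :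
  G ⊢ isTriple t x y z -> G ⊢ isTriple t x' y' z' ->
  [/\ G ⊢ x ≐ x', G ⊢ y ≐ y' & G ⊢ z ≐ z'].
Proof.
move=> H H'.
have {H}: G ⊢ Ex (isPair 0 x.+1 y.+1 ∧ isPair t.+1 0 z.+1).
  by obtain u ut H1 from H; obtain q qu H2 from H1; witness q.
move=> H.
have {H'}: G ⊢ Ex (isPair 0 x'.+1 y'.+1 ∧ isPair t.+1 0 z'.+1).
  by obtain u ut H1 from H'; obtain q qu H2 from H1; witness q.
move=> H'.
suff: G ⊢ x ≐ x' ∧ y ≐ y' ∧ z ≐ z'.
  by case/and_elim=> ? /and_elim[].
obtain q Hq from H; obtain q' Hq' from H'.
have [Hxy Hz] := and_elim Hq; have [Hxy' Hz'] := and_elim Hq'.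
have [E Ez] := pair_inj Hz Hz'.
transport <- E in Hxy'.
by have [? ?] := pair_inj Hxy Hxy'; do 2?apply: prv_andI.
Qed.

(** The components of the pairs in a set lie in its double union.  Quantifiers
    over them thus become bounded, as Δ₀-separation requires. *)
Lemma field_ex G a : G ⊢ Ex (All (All (pairIn 1 0 a.+3 → 1 ∈ 2 ∧ 0 ∈ 2))).
Proof.
obtain u Hu from (all_elim a (prv_ax G CZF_union)).
obtain v Hv from (all_elim u (prv_ax G CZF_union)).
witness v; var x; var y; assume H.
obtain w wa Hw from H; obtain p pw H1 from Hw; obtain q qw H2 from H1.
have [_ /and_elim[/upair_elim[xq yq _] _]] := and_elim H2.
have qu: G ⊢ q ∈ u.
  by apply: iff_mpr (all_elim q Hu) _; witness w.
by apply: prv_andI; [apply: iff_mpr (all_elim x Hv) _|apply: iff_mpr (all_elim y Hv) _];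
  witness q.
Qed.

Lemma adjoin_ex G a p : G ⊢ Ex (All (0 ∈ 1 ↔ 0 ∈ a.+2 ∨ 0 ≐ p.+2)).
Proof.
obtain s Hs from (upair_ex G p p).
obtain c Hc from (upair_ex G a s).
have [ac sc Hac] := upair_elim Hc; have [ps _ _] := upair_elim Hs.
obtain u Hu from (all_elim c (prv_ax G CZF_union)).
witness u; var x; apply: prv_andI; assume H.
  have xc := iff_mp (all_elim x Hu) H.
  obtain y yc xy from xc.
  have [_ _ Hac'] := upair_elim Hc.
  cases E from (Hac' y yc).
    exact: prv_orI1 (mem_congr E xy).
  exact: prv_orI2 (singleton_elim Hs (mem_congr E xy)).
apply: iff_mpr (all_elim x Hu) _.
cases E from H; [witness a|witness s] => //.
by transport E.
Qed.

(** The truth value that is read off from a name.  The bounds make it Δ₀: in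
    ⟨f, d⟩ = {{f}, {f, d}} both f and d are members of the same member. *)
Definition hasPair (c : nat) : form :=
  ExIn c (ExIn 0 (ExIn 0 (ExIn 1 (isPair 3 1 0))))%F.

Lemma hasPair_intro G f d c : G ⊢ pairIn f d c -> G ⊢ hasPair c.
Proof.
move=> H; obtain w wc Hw from H; have H1 := Hw; obtain p pw Hp from H1.
obtain q qw Hq from Hp.
have [_ /and_elim[/upair_elim[fq dq _] _]] := and_elim Hq.
by witness w => //; witness q => //; witness f => //; witness d.
Qed.

Lemma hasPair_elim G c : G ⊢ hasPair c -> G ⊢ Ex (Ex (pairIn 1 0 c.+2)).
Proof.
move=> H; obtain w wc H1 from H; obtain q qw H2 from H1.
obtain f fq H3 from H2; obtain d dq Hw from H3.
by witness f; witness d; witness w.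
Qed.

Lemma pairIn_subset G a b x y :
  G ⊢ isSubset a b -> G ⊢ pairIn x y a -> G ⊢ pairIn x y b.
Proof.
by move=> sub H; obtain w wa Hw from H; witness w => //; apply: allIn_elim sub wa.
Qed.

Lemma one_unique G x y : G ⊢ isOne x -> G ⊢ isOne y -> G ⊢ x ≐ y.
Proof.
move=> /and_elim[Ex Hx] /and_elim[Ey Hy]; apply: extensionality; var t in Ht.
  obtain e ey He from Ey.
  by have E := empty_unique He (allIn_elim Hx Ht); transport <- E.
obtain e ex He from Ex.
by have E := empty_unique He (allIn_elim Hy Ht); transport <- E.
Qed.

Lemma decided_iff G phi psi :
  G ⊢ phi ↔ psi -> G ⊢ ¬ phi ∨ ¬ ¬ phi -> G ⊢ ¬ psi ∨ ¬ ¬ psi.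
Proof.
move=> E dec; cases H from dec; [apply: prv_orI1|apply: prv_orI2].
  by assume Hpsi; apply: not_elim H (iff_mpr E Hpsi).
assume Hn; apply: not_elim H _; assume Hphi.
exact: not_elim Hn (iff_mp E Hphi).
Qed.

(** * Partial combinatory algebras *)

Definition mapA (r : nat -> nat) (A : pcaVars) : pcaVars :=
  PcaVars (r (car A)) (r (graph A)) (r (pr A)) (r (pr0 A)) (r (pr1 A))
          (r (num0 A)) (r (num1 A)).

Lemma mapA_inst t A : mapA (scons t id) (liftA 1 A) = A.
Proof. by case: A. Qed.

(** The part of s a b c ≃ a c (b c) that is needed of h = s a b, with the three
    intermediate values as witnesses of definedness. *)
Definition sFun (A : pcaVars) (h a b : nat) : form :=
  AllIn (car A) (AllIn (car A).+1 (AllIn (car A).+2 (AllIn (car A).+3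
    (appl (liftA 4 A) a.+4 3 2 ∧ appl (liftA 4 A) b.+4 3 1
       ∧ appl (liftA 4 A) 2 1 0 → appl (liftA 4 A) h.+4 3 0))))%F.

Definition constFun (A : pcaVars) (k v : nat) : form :=
  (k ∈ car A ∧ v ∈ car A ∧ AllIn (car A) (appl (liftA 1 A) k.+1 0 v.+1))%F.

Definition codes (A : pcaVars) (e a b : nat) : form :=
  ((e ∈ car A ∧ a ∈ car A ∧ b ∈ car A)
   ∧ appl A (pr0 A) e a ∧ appl A (pr1 A) e b)%F.

Lemma ren_inV r A x : ren r (inV A x) = inV (mapA r A) (r x).
Proof. by []. Qed.
Lemma ren_withApp r A e f phi :
  ren r (withApp A e f phi) = withApp (mapA r A) (r e) (r f) (ren (up r) phi).
Proof. by []. Qed.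

Hint Rewrite mapA_inst ren_inV ren_withApp : renaming.

Lemma appl_func G A e f v v' :
  G ⊢ isPartialOp A -> G ⊢ e ∈ car A -> G ⊢ f ∈ car A ->
  G ⊢ v ∈ car A -> G ⊢ v' ∈ car A ->
  G ⊢ appl A e f v -> G ⊢ appl A e f v' -> G ⊢ v ≐ v'.
Proof.
move=> /and_elim[_ H] He Hf Hv Hv' H1 H2.
apply: prv_impE (prv_andI H1 H2).
exact: allIn_elim (allIn_elim (allIn_elim (allIn_elim H He) Hf) Hv) Hv'.
Qed.

Lemma withApp_intro G A e f v phi :
  G ⊢ v ∈ car A -> G ⊢ appl A e f v -> G ⊢ inst v phi ->
  G ⊢ withApp A e f phi.
Proof. by move=> Hv Ha H; witness v => //; apply: prv_andI. Qed.

Lemma withApp_elim G A e f phi chi :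
  G ⊢ withApp A e f phi ->
  (forall v G', G ⊑ G' -> G' ⊢ v ∈ car A -> G' ⊢ appl A e f v ->
     G' ⊢ inst v phi -> G' ⊢ chi) ->
  G ⊢ chi.
Proof.
move=> H Hchi; apply: exIn_elim H _ => v G' s Hv /and_elim[Ha H].
exact: Hchi s Hv Ha H.
Qed.

Tactic Notation "evaluate" ident(v) ident(Hv) ident(Ha) ident(H) "from" constr(E) :=
  refine (withApp_elim E _); intros v; intro_world; intros Hv Ha H; normal H.

Lemma sFun_app G A h a b c y z v :
  G ⊢ sFun A h a b -> G ⊢ c ∈ car A -> G ⊢ y ∈ car A ->
  G ⊢ z ∈ car A -> G ⊢ v ∈ car A ->
  G ⊢ appl A a c y -> G ⊢ appl A b c z -> G ⊢ appl A y z v ->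
  G ⊢ appl A h c v.
Proof.
move=> H Hc Hy Hz Hv H1 H2 H3.
apply: prv_impE (prv_andI H1 (prv_andI H2 H3)).
exact: allIn_elim (allIn_elim (allIn_elim (allIn_elim H Hc) Hy) Hz) Hv.
Qed.

Record pca_axioms G A : Prop := PcaAxioms {
  pca_op : G ⊢ isPartialOp A;
  pca_k : G ⊢ ExIn (car A) (isK (liftA 1 A) 0);
  pca_s : G ⊢ ExIn (car A) (isS (liftA 1 A) 0);
  pca_pr : G ⊢ pr A ∈ car A;
  pca_pairing : G ⊢ isPairing A;
  pca_num0 : G ⊢ num0 A ∈ car A;
  pca_num1 : G ⊢ num1 A ∈ car A }.

Lemma pcaP G A : G ⊢ isPCA A -> pca_axioms G A.
Proof.
by case/and_elim=> ? /and_elim[? /and_elim[? /and_elim[? /and_elim[_ /and_elim[_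
  /and_elim[? /and_elim[? /and_elim[? _]]]]]]]].
Qed.

Lemma k_ex G A : G ⊢ isPCA A ->
  G ⊢ ExIn (car A) (AllIn (car A).+1 (ExIn (car A).+2
        (appl (liftA 3 A) 2 1 0 ∧ constFun (liftA 3 A) 0 1))).
Proof.
move=> pca; have op := pca_op (pcaP pca); obtain k kA Hk from (pca_k (pcaP pca)).
witness k => //; var a in aA.
have H0 := allIn_elim (allIn_elim Hk aA) aA.
evaluate ka kaA Hka H1 from H0.
witness ka => //; apply: prv_andI => //; do 2!apply: prv_andI => //.
var b in bA; have H2 := allIn_elim (allIn_elim Hk aA) bA.
evaluate ka' kaA' Hka' H3 from H2.
have E := appl_func op kA aA kaA' kaA Hka' Hka.
by transport E in H3.
Qed.

(** As s a is the same element for all b, partial applications such as s a can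
    themselves be returned by constant functions. *)
Lemma s_ex G A : G ⊢ isPCA A ->
  G ⊢ ExIn (car A) (AllIn (car A).+1 (ExIn (car A).+2
    (appl (liftA 3 A) 2 1 0 ∧
     AllIn (car A).+3 (ExIn (car A).+4
       (appl (liftA 5 A) 2 1 0 ∧ sFun (liftA 5 A) 0 3 1))))).
Proof.
move=> pca; have op := pca_op (pcaP pca); obtain s sA Hs from (pca_s (pcaP pca)).
witness s => //; var a in aA.
have sab : G ⊢ AllIn (car A) (withApp (liftA 1 A) s.+1 a.+1
    (withApp (liftA 2 A) 0 1 (sFun (liftA 3 A) 0 a.+3 2))).
  var b in bA; have H := allIn_elim (allIn_elim Hs aA) bA.
  evaluate sa saA Hsa H1 from H; apply: (withApp_intro saA Hsa); fold_inst.
  evaluate h hA Hh H2 from H1; apply: (withApp_intro hA Hh); fold_inst.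
  var c in cA; var y in yA; var z in zA; var v in vA; assume E.
  have [E1 /and_elim[E2 E3]] := and_elim E.
  apply: iff_mpr (allIn_elim (allIn_elim H2 cA) vA) _.
  apply: (withApp_intro yA E1).
  exact: (withApp_intro zA E2).
have H0 := allIn_elim sab aA.
evaluate sa saA Hsa H1 from H0.
witness sa => //; apply: prv_andI => //; var b in bA.
have Hb := allIn_elim sab bA.
evaluate sa' saA' Hsa' H2 from Hb.
have E := appl_func op sA aA saA' saA Hsa' Hsa.
transport E in H2.
evaluate h hA Hh H3 from H2.
by witness h => //; apply: prv_andI.
Qed.

Lemma const_app G A k v x :
  G ⊢ constFun A k v -> G ⊢ x ∈ car A -> G ⊢ appl A k x v.
Proof. by move=> /and_elim[_ /and_elim[_ H]] /(allIn_elim H). Qed.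

(** The realizer of c = c for every c in V(A) is e = p w w, where w f = p f e:
    a pair ⟨f, d⟩ ∈ c is answered by f, naming the same d, together with e again. *)
Definition idRealizer (A : pcaVars) (e : nat) : form :=
  ExIn (car A) (codes (liftA 1 A) e.+1 0 0
    ∧ AllIn (car A).+1 (ExIn (car A).+2 (appl (liftA 3 A) 2 1 0
         ∧ codes (liftA 3 A) 0 1 e.+3)))%F.

Lemma ren_idRealizer r A e : ren r (idRealizer A e) = idRealizer (mapA r A) (r e).
Proof. by []. Qed.
Hint Rewrite ren_idRealizer : renaming.

Lemma pairing_app G A a b : G ⊢ isPCA A -> G ⊢ a ∈ car A -> G ⊢ b ∈ car A ->
  G ⊢ withApp A (pr A) a (withApp (liftA 1 A) 0 b.+1
        (codes (liftA 2 A) 0 a.+2 b.+2)).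
Proof.
move=> /pcaP/pca_pairing Hp aA bA; have H := allIn_elim (allIn_elim Hp aA) bA.
evaluate pa paA Hpa H1 from H; evaluate c cA Hc H2 from H1.
apply: (withApp_intro paA Hpa); apply: (withApp_intro cA Hc).
by apply: prv_andI => //; do 2!apply: prv_andI => //.
Qed.

Lemma code_ex G A a b : G ⊢ isPCA A -> G ⊢ a ∈ car A -> G ⊢ b ∈ car A ->
  G ⊢ Ex (codes (liftA 1 A) 0 a.+1 b.+1).
Proof.
move=> pca aA bA; have H := pairing_app pca aA bA.
by evaluate pa paA Hpa H1 from H; evaluate c cA Hc H2 from H1; witness c.
Qed.

Lemma const_ex G A v : G ⊢ isPCA A -> G ⊢ v ∈ car A ->
  G ⊢ Ex (constFun (liftA 1 A) 0 v.+1).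
Proof.
move=> pca vA; obtain k kA Hk from (k_ex pca).
obtain kv kvA H from (allIn_elim Hk vA).
by witness kv; case/and_elim: H.
Qed.

(** The self-reference is solved by self-application: with D x = p x x and
    u = λx. λf. p f (D (x x)), the element w = u u satisfies w f = p f (D w), and
    e = D w.  The abstraction is done by hand; the body under λf is written with
    s and k so that it is defined even where x x is not. *)
Lemma idRealizer_ex G A : G ⊢ isPCA A -> G ⊢ ExIn (car A) (idRealizer (liftA 1 A) 0).
Proof.
move=> pca; have pA := pca_pr (pcaP pca).
obtain k kA Hk from (k_ex pca); obtain s sA Hs from (s_ex pca).
(* x0 = λx. s (k x) (k x) *)
obtain ks ksA H from (allIn_elim Hk sA); case/and_elim: H => _ Cks.
obtain sks sksA H from (allIn_elim Hs ksA); case/and_elim: H => _ H1.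
obtain m mA H from (allIn_elim H1 kA); case/and_elim: H => _ Sm; clear H1.
obtain sm smA H from (allIn_elim Hs mA); case/and_elim: H => _ H1.
obtain x0 x0A H from (allIn_elim H1 kA); case/and_elim: H => _ Sx0; clear H1.
(* D = λx. p x x *)
obtain sk skA H from (allIn_elim Hs kA); case/and_elim: H => _ H1.
obtain i iA H from (allIn_elim H1 kA); case/and_elim: H => _ Si; clear H1.
obtain sp spA H from (allIn_elim Hs pA); case/and_elim: H => _ Hsp.
obtain D DA H from (allIn_elim Hsp iA); case/and_elim: H => _ SD.
(* u = λx. s p (s (k D) (x0 x)) *)
obtain kD kDA H from (allIn_elim Hk DA); case/and_elim: H => _ CkD.
obtain skD skDA H from (allIn_elim Hs kDA); case/and_elim: H => _ HskD.
obtain kskD kskDA H from (allIn_elim Hk skDA); case/and_elim: H => _ CkskD.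
obtain skskD skskDA H from (allIn_elim Hs kskDA); case/and_elim: H => _ H1.
obtain q qA H from (allIn_elim H1 x0A); case/and_elim: H => _ Sq; clear H1.
obtain ksp kspA H from (allIn_elim Hk spA); case/and_elim: H => _ Cksp.
obtain sksp skspA H from (allIn_elim Hs kspA); case/and_elim: H => _ H1.
obtain u uA H from (allIn_elim H1 qA); case/and_elim: H => _ Su; clear H1.
(* w = u u *)
obtain ku kuA H from (allIn_elim Hk uA); case/and_elim: H => Eku Cku.
obtain sku skuA H from (allIn_elim Hs kuA); case/and_elim: H => Esku H1.
obtain X XA H from (allIn_elim H1 kuA); case/and_elim: H => EX SX; clear H1.
obtain qu quA H from (allIn_elim HskD XA); case/and_elim: H => Equ Squ.
obtain w wA H from (allIn_elim Hsp quA); case/and_elim: H => Ew Sw.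
have Emu := sFun_app Sm uA sA kuA skuA (const_app Cks uA) Eku Esku.
have Ex0u := sFun_app Sx0 uA skuA kuA XA Emu Eku EX.
have Eq := sFun_app Sq uA skDA XA quA (const_app CkskD uA) Ex0u Equ.
have Euu := sFun_app Su uA spA quA wA (const_app Cksp uA) Eq Ew.
have H1 := pairing_app pca wA wA.
evaluate pw pwA Epw H2 from H1; evaluate e eA Ee Ce from H2.
obtain kw kwA H from (allIn_elim Hk wA); case/and_elim: H => Ekw Ckw.
have Eiw := sFun_app Si wA kwA kwA wA Ekw Ekw (const_app Ckw kwA).
have EDw := sFun_app SD wA pwA wA eA Epw Eiw Ee.
witness e => //; witness w => //; apply: prv_andI => //; var f in fA.
have H3 := pairing_app pca fA eA.
evaluate pf pfA Epf H4 from H3; evaluate r rA Er Cr from H4.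
have EXf := sFun_app SX fA uA uA wA (const_app Cku fA) (const_app Cku fA) Euu.
have Equf := sFun_app Squ fA DA wA eA (const_app CkD fA) EXf EDw.
witness r => //; apply: prv_andI => //.
exact: sFun_app Sw fA pfA eA rA Epf Equf Er.
Qed.

(** * Elements of V(A) *)

Lemma ord_mem G a b : G ⊢ isOrd a -> G ⊢ b ∈ a -> G ⊢ isOrd b.
Proof.
move=> /and_elim[tra tran] ba; apply: prv_andI; first exact: allIn_elim tran ba.
var c in cb; apply: allIn_elim tran _.
exact: allIn_elim (allIn_elim tra ba) cb.
Qed.

Lemma stageClosed_elim G A g b y :
  G ⊢ stageClosed A g -> G ⊢ pairIn b y g ->
  G ⊢ ExIn b (AllIn y.+1 (ExIn (car A).+2 (Ex
        (isPair 2 1 0 ∧ pairIn 3 0 g.+4)))).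
Proof. by move=> Hg; apply: prv_impE (all_elim y (all_elim b Hg)). Qed.

(** The witness β ∈ α of the stage of x serves as the stage of every c that
    occurs in x. *)
Lemma inV_mem G A x h c :
  G ⊢ inV A x -> G ⊢ pairIn h c x -> G ⊢ h ∈ car A ∧ inV A c.
Proof.
move=> HV Hhc; obtain al Hal from HV; have [ord Hst] := and_elim Hal.
obtain g Hg from Hst; have [cl Hgx] := and_elim Hg.
obtain be bal H from (stageClosed_elim cl Hgx).
obtain w wx Hw from Hhc.
obtain a aA H1 from (allIn_elim H wx); obtain c' H2 from H1.
have [Hw' Hg'] := and_elim H2; have [E1 E2] := pair_inj Hw Hw'.
transport E1; transport E2; apply: prv_andI => //.
witness be; apply: prv_andI; first exact: ord_mem ord bal.
by witness g; apply: prv_andI.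
Qed.

(** The clause for a stage is inherited by subsets, so adding ⟨α, z⟩ to the set
    that witnesses the stage α of x keeps it closed. *)
Lemma inV_subset G A x z : G ⊢ inV A x -> G ⊢ isSubset z x -> G ⊢ inV A z.
Proof.
move=> HV sub; obtain al Hal from HV; have [ord Hst] := and_elim Hal.
obtain g Hg from Hst; have [cl Hgx] := and_elim Hg.
obtain p Hp from (pair_ex G al z).
obtain g' Hg' from (adjoin_ex G g p).
witness al; apply: prv_andI => //; witness g'; apply: prv_andI; last first.
  by witness p => //; apply: iff_mpr (all_elim p Hg') (prv_orI2 _ eql_refl).
have sub': G ⊢ isSubset g g'.
  by var t in tg; apply: iff_mpr (all_elim t Hg') (prv_orI1 _ tg).
var be; var y; assume H.
have: G ⊢ Ex (pairIn be.+1 0 g.+1 ∧ isSubset y.+1 0).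
  obtain w wg Hw from H; cases H1 from (iff_mp (all_elim w Hg') wg).
    witness y; apply: prv_andI; first by witness w.
    by var t in ty.
  transport H1 in Hw; have [E1 E2] := pair_inj Hp Hw.
  transport <- E1; transport <- E2.
  by witness x; apply: prv_andI.
move=> H1; obtain y' H2 from H1; have [H3 H4] := and_elim H2.
obtain ga gb H5 from (stageClosed_elim cl H3).
witness ga => //; var w in wy.
obtain a aA H6 from (allIn_elim H5 (allIn_elim H4 wy)); obtain c H7 from H6.
witness a => //; witness c.
have [H8 H9] := and_elim H7; apply: prv_andI => //.
by obtain t tg Ht from H9; witness t => //; apply: allIn_elim sub' tg.
Qed.

(** The set o = {⟨0, ∅⟩}, where z is the empty set, names 1 in V(A). *)
Definition oneName (A : pcaVars) (o z : nat) : form :=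
  (isEmpty z ∧ ExIn o (isPair 0 (num0 A).+1 z.+1)
     ∧ AllIn o (isPair 0 (num0 A).+1 z.+1))%F.

Lemma ren_oneName r A o z :
  ren r (oneName A o z) = oneName (mapA r A) (r o) (r z).
Proof. by []. Qed.
Hint Rewrite ren_oneName : renaming.

Lemma oneName_ex G A : G ⊢ Ex (Ex (oneName (liftA 2 A) 1 0)).
Proof.
obtain z Hz from (empty_ex G); obtain t Ht from (pair_ex G (num0 A) z).
obtain o Ho from (upair_ex G t t).
witness o; witness z; apply: prv_andI => //; apply: prv_andI.
  by witness t => //; have [] := upair_elim Ho.
by var t' in H; have E := singleton_elim Ho H; transport E.
Qed.

Lemma oneName_pairIn G A o z f d :
  G ⊢ oneName A o z -> G ⊢ pairIn f d o -> (G ⊢ f ≐ num0 A) /\ (G ⊢ d ≐ z).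
Proof.
move=> /and_elim[_ /and_elim[_ Ho]] H; apply: and_elim.
obtain w wo Hw from H; have [E1 E2] := pair_inj Hw (allIn_elim Ho wo).
exact: prv_andI.
Qed.

Lemma transitive_adjoin G a b : G ⊢ isTransitive a ->
  G ⊢ All (0 ∈ b.+1 ↔ 0 ∈ a.+1 ∨ 0 ≐ a.+1) -> G ⊢ isTransitive b.
Proof.
move=> tra Hb; var x in xb; var y in yx.
apply: iff_mpr (all_elim y Hb) (prv_orI1 _ _); fold_inst.
cases H from (iff_mp (all_elim x Hb) xb).
  exact: allIn_elim (allIn_elim tra H) yx.
exact: mem_congr H yx.
Qed.

(** The stages are 1 for ∅ and 2 for {⟨0, ∅⟩}, so {⟨1, ∅⟩, ⟨2, o⟩} is a witness. *)
Lemma inV_oneName G A o z : G ⊢ num0 A ∈ car A -> G ⊢ oneName A o z ->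
  G ⊢ inV A o.
Proof.
move=> n0A Ho; have [Hz /and_elim[_ Hall]] := and_elim Ho.
obtain i Hi from (adjoin_ex G z z); obtain j Hj from (adjoin_ex G i i).
have trz: G ⊢ isTransitive z by var t in tz; apply: empty_elim Hz tz.
have tri := transitive_adjoin trz Hi.
have zi: G ⊢ z ∈ i by apply: iff_mpr (all_elim z Hi) (prv_orI2 _ eql_refl).
have ij: G ⊢ i ∈ j by apply: iff_mpr (all_elim i Hj) (prv_orI2 _ eql_refl).
obtain p Hp from (pair_ex G i z); obtain q Hq from (pair_ex G j o).
obtain g Hg from (upair_ex G p q); have [pg qg Hpq] := upair_elim Hg.
witness j; apply: prv_andI.
  apply: prv_andI; first exact: transitive_adjoin tri Hj.
  var x in xj; cases H from (iff_mp (all_elim x Hj) xj).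
    cases H1 from (iff_mp (all_elim x Hi) H).
      exact: empty_elim Hz H1.
    by transport H1.
  by transport H.
witness g; apply: prv_andI; last by witness q.
var be; var y; assume H.
obtain w wg Hw from H; have [_ _ Hpq'] := upair_elim Hg.
cases E from (Hpq' w wg); transport E in Hw.
  have [E1 E2] := pair_inj Hp Hw; transport <- E1; transport <- E2.
  by witness z => //; var x in xz; apply: empty_elim Hz xz.
have [E1 E2] := pair_inj Hq Hw; transport <- E1; transport <- E2.
witness i => //; var x in xo; witness (num0 A) => //; witness z.
by apply: prv_andI; [exact: allIn_elim Hall xo|witness p].
Qed.

(** * Realized equations *)

Lemma rMemIn_elim G A g v d b :
  G ⊢ rMemIn A g v d b -> G ⊢ Ex (Ex (pairIn 1 0 b.+2)).
Proof.
move=> H; evaluate v0 v0A E0 H0 from H; evaluate v1 v1A E1 H1 from H0.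
obtain c Hc from H1; case/and_elim: Hc => ? _.
by witness v0; witness c.
Qed.

(** A realizer of a = b sends a pair in either set to one in the other: this is
    all the information that is ever extracted from a realized equation. *)
Lemma rEql_hasPair G A e a b :
  G ⊢ rEql A e a b -> G ⊢ hasPair a ↔ hasPair b.
Proof.
move=> H; obtain g Hg from H; have [cl He] := and_elim Hg.
have Hcl := prv_impE (all_elim b (all_elim a (all_elim e cl))) He.
have Hcl1: G ⊢ rEqlClause A g e a b by exact: Hcl.
clear Hcl; apply: prv_andI; assume Hp.
- obtain f Hf from (hasPair_elim Hp); obtain d Hd from Hf.
  have [H1 _] := and_elim (all_elim d (all_elim f Hcl1)).
  evaluate v0 v0A E0 H2 from (prv_impE H1 Hd).
  evaluate v v1A E1 H3 from H2.
  obtain u Hu from (rMemIn_elim H3); obtain c Hc from Hu.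
  exact: hasPair_intro Hc.
- obtain f Hf from (hasPair_elim Hp); obtain d Hd from Hf.
  have [_ H1] := and_elim (all_elim d (all_elim f Hcl1)).
  evaluate v0 v0A E0 H2 from (prv_impE H1 Hd).
  evaluate v v1A E1 H3 from H2.
  obtain u Hu from (rMemIn_elim H3); obtain c Hc from Hu.
  exact: hasPair_intro Hc.
Qed.

(** Without pairs the clause holds vacuously, whatever the realizer. *)
Lemma rEql_noPair G A e a b :
  G ⊢ ¬ hasPair a -> G ⊢ ¬ hasPair b -> G ⊢ rEql A e a b.
Proof.
move=> Ha Hb; obtain t Ht from (triple_ex G e a b).
obtain g Hg from (upair_ex G t t); have [tg _ _] := upair_elim Hg.
witness g; apply: prv_andI; last by witness t.
var e'; var a'; var b'; assume H.
obtain t' tg' Ht' from H; have E := singleton_elim Hg tg'; transport E in Ht'.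
have [_ Ea Eb] := triple_inj Ht Ht'.
var f; var d; apply: prv_andI; assume Hp.
  transport <- Ea in Hp; exact: not_elim Ha (hasPair_intro Hp).
transport <- Eb in Hp; exact: not_elim Hb (hasPair_intro Hp).
Qed.

Lemma codes_elim G A e a b : G ⊢ codes A e a b ->
  [/\ G ⊢ e ∈ car A, G ⊢ a ∈ car A, G ⊢ b ∈ car A,
      G ⊢ appl A (pr0 A) e a & G ⊢ appl A (pr1 A) e b].
Proof. by move=> /and_elim[/and_elim[? /and_elim[? ?]] /and_elim[? ?]]. Qed.

(** The set that witnesses c ∈ V(A) already contains all names below c.  Hence
    {⟨⟨e, d⟩, d⟩} with d ranging over them is closed under the clause for
    equality; this witness takes the place of an induction on c. *)
Lemma rEql_refl G A e c : G ⊢ idRealizer A e -> G ⊢ inV A c ->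
  G ⊢ rEql A e c c.
Proof.
move=> He HV; obtain al Hal from HV; have [_ Hst] := and_elim Hal.
obtain g Hg from Hst; have [cl Hgx] := and_elim Hg.
obtain u Hu from (field_ex G g).
separate T HT from u by (ExIn u.+1 (pairIn 0 1 g.+2)).
have HT1 a d : G ⊢ pairIn a d g -> G ⊢ d ∈ T.
  move=> H; have [H1 H2] := and_elim (prv_impE (all_elim d (all_elim a Hu)) H).
  by apply: iff_mpr (all_elim d HT) _; apply: prv_andI => //; witness a.
have cT: G ⊢ c ∈ T by apply: HT1 Hgx.
clear HT1.
have tot: G ⊢ AllIn T (Ex (isTriple 0 e.+2 1 1)).
  by var d in dT; obtain t Ht from (triple_ex G e d d); witness t.
refine (strong_collection tot _) => r; intro_world => Hr1 Hr2.
witness r; apply: prv_andI; last first.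
  by obtain t tr Ht from (allIn_elim Hr1 cT); witness t.
var e'; var a; var b; assume H.
obtain t tr Ht from H; obtain d dT Hd from (allIn_elim Hr2 tr).
have [E1 E2 E3] := triple_inj Hd Ht.
transport <- E1; transport <- E2; transport <- E3.
obtain w wA Hw from He; have [Ce Hw'] := and_elim Hw.
have [eA _ _ Ee0 Ee1] := codes_elim Ce.
have step: G ⊢ All (All (pairIn 1 0 d.+2 → withApp (liftA 2 A) w.+2 1
     (rMemIn (liftA 3 A) r.+3 0 1 d.+3))).
  var f; var y; assume Hp.
  have [_ Hd1] := and_elim (iff_mp (all_elim d HT) dT).
  obtain be beu Hbe from Hd1; obtain ga gab H1 from (stageClosed_elim cl Hbe).
  obtain s sd Hs from Hp; obtain a' aA H2 from (allIn_elim H1 sd).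
  obtain c' H3 from H2; have [Hs' Hga] := and_elim H3.
  have [E4 E5] := pair_inj Hs' Hs.
  transport E4 in aA; transport E5 in Hga.
  obtain v vA H4 from (allIn_elim Hw' aA); have [Ev Cv] := and_elim H4.
  have [_ _ _ Ev0 Ev1] := codes_elim Cv.
  apply: (withApp_intro vA Ev); apply: (withApp_intro aA Ev0).
  apply: (withApp_intro eA Ev1); witness y; apply: prv_andI; first by witness s.
  have [H5 H6] := and_elim (prv_impE (all_elim y (all_elim ga Hu)) Hga).
  have yT: G ⊢ y ∈ T.
    by apply: iff_mpr (all_elim y HT) _; apply: prv_andI => //; witness ga.
  by obtain q qr Hq from (allIn_elim Hr1 yT); witness q.
by var f; var y; apply: prv_andI; assume Hp;
  [apply: (withApp_intro wA Ee0)|apply: (withApp_intro wA Ee1)];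
  apply: prv_impE (all_elim y (all_elim f step)) Hp.
Qed.

(** * The clauses of realizability as rules *)

Lemma ren_withSnd r A e phi :
  ren r (withSnd A e phi) = withSnd (mapA r A) (r e) (ren (up r) phi).
Proof. by []. Qed.

Lemma ren_rlz phi r A A' e e' rho rho' :
  mapA r A = A' -> r e = e' -> (forall x, r (rho x) = rho' x) ->
  ren r (rlz A e rho phi) = rlz A' e' rho' phi.
Proof.
elim: phi r A A' e e' rho rho' =>
  [x y|x y|f IHf g IHg|f IHf g IHg|f IHf g IHg|f IHf|a f IHf|a f IHf|f IHf|f IHf]
  r A A' e e' rho rho' <- <- Hr; cbn [rlz ren];
  rewrite ?ren_withFst ?ren_withSnd ?ren_withApp ?ren_appl -?Hr //;
  do ?[congr And|congr Or|congr Imp|congr Not|congr All|congr Ex|congr AllIn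
      |congr ExIn|congr withFst|congr withSnd|congr withApp]; cbn [ren];
  rewrite ?ren_withSnd ?ren_withApp;
  do ?[congr Ex|congr And|congr withSnd|congr withApp];
  (apply: IHf || apply: IHg) => //; case=> [|x]; rewrite /liftv /= -?Hr //.
Qed.

(** The two shapes in which [rlz] occurs below the binder of its own clauses: with
    the environment lifted, and with the bound variable put on top of it. *)
Lemma inst_rlz phi t A e rho :
  inst t (rlz (liftA 1 A) e (liftv 1 rho) phi) = rlz A (scons t id e) rho phi.
Proof. by apply: ren_rlz => //; apply: mapA_inst. Qed.

Lemma inst_rlz_scons phi t A e rho :
  inst t (rlz (liftA 1 A) e (scons 0 (liftv 1 rho)) phi)
  = rlz A (scons t id e) (scons t rho) phi.
Proof. by apply: ren_rlz; [apply: mapA_inst| |case]. Qed.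

Lemma rlz_and_intro G A e a b rho phi psi :
  G ⊢ codes A e a b -> G ⊢ rlz A a rho phi -> G ⊢ rlz A b rho psi ->
  G ⊢ rlz A e rho (phi ∧ psi).
Proof.
move=> /codes_elim[eA aA bA Ea Eb] Ha Hb; apply: prv_andI.
  by apply: (withApp_intro aA Ea); rewrite inst_rlz.
by apply: (withApp_intro bA Eb); rewrite inst_rlz.
Qed.

Lemma rlz_and_elim2 G A e rho phi psi chi :
  G ⊢ rlz A e rho (phi ∧ psi) ->
  (forall v G', G ⊑ G' -> G' ⊢ v ∈ car A -> G' ⊢ rlz A v rho psi -> G' ⊢ chi) ->
  G ⊢ chi.
Proof.
move=> /and_elim[_ H] Hchi; apply: withApp_elim H _ => v G' s vA _.
by rewrite inst_rlz; apply: Hchi.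
Qed.

Lemma rlz_imp_intro G A e rho phi psi :
  (forall f G', G ⊑ G' -> G' ⊢ f ∈ car A -> G' ⊢ rlz A f rho phi ->
    G' ⊢ withApp A e f (rlz (liftA 1 A) 0 (liftv 1 rho) psi)) ->
  G ⊢ rlz A e rho (phi → psi).
Proof.
move=> H; apply: allIn_intro => f G' s fA; rewrite /inst; cbn [ren].
apply: imp_intro => G'' s'.
rewrite -/(inst f _) inst_rlz => Hf.
have ss' : G ⊑ G'' by move=> ? /s /s'.
have := H _ _ ss' (prv_weaken s' fA) Hf; congr prv.
rewrite /inst ren_withApp mapA_inst; congr withApp.
by apply/esym/ren_rlz => //; case: (A).
Qed.

Lemma rlz_imp_elim G A e f rho phi psi :
  G ⊢ rlz A e rho (phi → psi) -> G ⊢ f ∈ car A -> G ⊢ rlz A f rho phi ->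
  G ⊢ withApp A e f (rlz (liftA 1 A) 0 (liftv 1 rho) psi).
Proof.
move=> H fA Hf; have := allIn_elim H fA; rewrite /inst; cbn [ren].
rewrite -/(inst f _) inst_rlz => /prv_impE/(_ Hf); congr prv.
rewrite ren_withApp mapA_inst; congr withApp.
by apply: ren_rlz => //; case: (A).
Qed.

Lemma rlz_not_intro G A e rho phi :
  (forall f G', G ⊑ G' -> G' ⊢ f ∈ car A -> G' ⊢ rlz A f rho phi ->
     G' ⊢ absurd) ->
  G ⊢ rlz A e rho (¬ phi).
Proof.
move=> H; apply: not_intro => G' s Hex; apply: exIn_elim Hex _ => f G'' s' fA.
by rewrite inst_rlz; apply: H fA => ? /s /s'.
Qed.

Lemma rlz_not_elim G A e f rho phi chi :
  G ⊢ rlz A e rho (¬ phi) -> G ⊢ f ∈ car A -> G ⊢ rlz A f rho phi ->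
  G ⊢ chi.
Proof.
move=> H fA Hf; apply: not_elim H _.
by apply: exIn_intro fA _; rewrite inst_rlz.
Qed.
Arguments rlz_not_elim {G A e f rho phi chi}.

Lemma rlz_or_intro1 G A e b rho phi psi :
  G ⊢ codes A e (num0 A) b -> G ⊢ rlz A b rho phi ->
  G ⊢ rlz A e rho (phi ∨ psi).
Proof.
move=> /codes_elim[eA aA bA Ea Eb] Hb; apply: prv_orI1; apply: prv_andI => //.
by apply: (withApp_intro bA Eb); rewrite inst_rlz.
Qed.

Lemma rlz_or_intro2 G A e b rho phi psi :
  G ⊢ codes A e (num1 A) b -> G ⊢ rlz A b rho psi ->
  G ⊢ rlz A e rho (phi ∨ psi).
Proof.
move=> /codes_elim[eA aA bA Ea Eb] Hb; apply: prv_orI2; apply: prv_andI => //.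
by apply: (withApp_intro bA Eb); rewrite inst_rlz.
Qed.

Lemma rlz_allIn_intro G A e a rho phi :
  (forall f d G', G ⊑ G' -> G' ⊢ pairIn f d (rho a) ->
    G' ⊢ withApp A e f (rlz (liftA 1 A) 0 (scons d.+1 (liftv 1 rho)) phi)) ->
  G ⊢ rlz A e rho (AllIn a phi).
Proof.
move=> H; cbn [rlz]; apply: all_intro => f; rewrite /inst; cbn [ren].
apply: all_intro => d; rewrite /inst; cbn [ren]; apply: imp_intro => G' s.
rewrite !ren_pairIn => Hp; have := H f d G' s Hp; congr prv.
rewrite !ren_withApp; congr withApp.
by rewrite !ren_comp; apply/esym/ren_rlz => //; case.
Qed.

(** The bounded universal statements about 1 and its subsets have realizers that
    can ignore the element, hence constant functions. *)
Lemma rlz_allIn_const G A e v a rho phi :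
  G ⊢ constFun A e v ->
  (forall f d G', G ⊑ G' -> G' ⊢ pairIn f d (rho a) ->
    (G' ⊢ f ∈ car A) /\ (G' ⊢ rlz A v (scons d rho) phi)) ->
  G ⊢ rlz A e rho (AllIn a phi).
Proof.
move=> He H; apply: rlz_allIn_intro => f d G' s Hp.
have [fA Hv] := H f d G' s Hp; have {}He := prv_weaken s He.
have vA : G' ⊢ v ∈ car A by case/and_elim: He => _ /and_elim[].
apply: withApp_intro vA (const_app He fA) _.
move: Hv; congr prv; apply/esym/ren_rlz => //; first by case: (A).
by case.
Qed.

Lemma rlz_exIn_intro G A e u v c a rho phi :
  G ⊢ codes A e u v -> G ⊢ pairIn u c (rho a) ->
  G ⊢ rlz A v (scons c rho) phi ->
  G ⊢ rlz A e rho (ExIn a phi).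
Proof.
move=> /codes_elim[eA uA vA Eu Ev] Hp Hv.
apply: (withApp_intro uA Eu); rewrite /inst ren_withSnd mapA_inst.
apply: (withApp_intro vA Ev); rewrite /inst; cbn [ren].
apply: (ex_intro (t := c)); rewrite /inst; cbn [ren]; apply: prv_andI => //.
move: Hv; congr prv; rewrite !ren_comp; apply/esym/ren_rlz => //.
  by case: (A).
by case.
Qed.

Lemma rlz_all_intro G A e rho phi :
  (forall c G', G ⊑ G' -> G' ⊢ inV A c -> G' ⊢ rlz A e (scons c rho) phi) ->
  G ⊢ rlz A e rho (All phi).
Proof.
move=> H; apply: all_intro => c; rewrite /inst; cbn [ren].
apply: imp_intro => G' s.
by rewrite ren_inV mapA_inst -/(inst c _) inst_rlz_scons; apply: H s.
Qed.

Lemma rlz_all_elim G A e rho phi c :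
  G ⊢ rlz A e rho (All phi) -> G ⊢ inV A c -> G ⊢ rlz A e (scons c rho) phi.
Proof.
move=> H HV; have := all_elim c H; rewrite /inst; cbn [ren].
by rewrite ren_inV mapA_inst -/(inst c _) inst_rlz_scons => /prv_impE; apply.
Qed.

Lemma rlz_ex_intro G A e rho phi c :
  G ⊢ inV A c -> G ⊢ rlz A e (scons c rho) phi -> G ⊢ rlz A e rho (Ex phi).
Proof.
move=> HV H; apply: (ex_intro (t := c)); rewrite /inst; cbn [ren].
by rewrite ren_inV mapA_inst -/(inst c _) inst_rlz_scons; apply: prv_andI.
Qed.

Lemma rlz_ex_elim G A e rho phi chi :
  G ⊢ rlz A e rho (Ex phi) ->
  (forall c G', G ⊑ G' -> G' ⊢ inV A c -> G' ⊢ rlz A e (scons c rho) phi ->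
     G' ⊢ chi) ->
  G ⊢ chi.
Proof.
move=> H Hchi; apply: ex_elim H _ => c G' s; rewrite /inst; cbn [ren].
rewrite ren_inV mapA_inst -/(inst c _) inst_rlz_scons => /and_elim[].
exact: Hchi.
Qed.

Lemma rMem_intro G A e u v a b c :
  G ⊢ codes A e u v -> G ⊢ pairIn u c b -> G ⊢ rEql A v a c ->
  G ⊢ rMem A e a b.
Proof.
move=> /codes_elim[eA uA vA Eu Ev] Hp Hv.
apply: (withApp_intro uA Eu); rewrite /inst ren_withSnd mapA_inst.
apply: (withApp_intro vA Ev).
by apply: (ex_intro (t := c)); apply: prv_andI.
Qed.

Lemma rMem_elim G A e a b chi :
  G ⊢ rMem A e a b ->
  (forall u v c G', G ⊑ G' -> G' ⊢ pairIn u c b -> G' ⊢ rEql A v a c ->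
    G' ⊢ chi) ->
  G ⊢ chi.
Proof.
move=> H Hchi; apply: withApp_elim H _ => u G1 s1 _ _.
rewrite /inst ren_withSnd mapA_inst => H; apply: withApp_elim H _ => v G2 s2 _ _ H.
apply: ex_elim H _ => c G3 s3 /and_elim[Hp Hv].
by apply: (Hchi u v c) Hp Hv => ? /s1 /s2 /s3.
Qed.

Lemma rlz_eql G A e rho phi c d :
  G ⊢ c ≐ d -> G ⊢ rlz A e (scons c rho) phi -> G ⊢ rlz A e (scons d rho) phi.
Proof.
move=> E H.
have inst_c x : inst x (rlz (liftA 1 A) e.+1 (scons 0 (liftv 1 rho)) phi)
    = rlz A e (scons x rho) phi by rewrite inst_rlz_scons.
by rewrite -inst_c; apply: eql_elim E _; rewrite inst_c.
Qed.

(** * Realizers for statements about 1 *)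

Lemma rlz_isEmpty G A e rho x :
  G ⊢ isEmpty (rho x) -> G ⊢ rlz A e rho (isEmpty x).
Proof.
move=> Hx; apply: rlz_allIn_intro => f d; intro_world => Hp.
by obtain w wx Hw from Hp; apply: empty_elim Hx wx.
Qed.

Lemma empty_noPair G z : G ⊢ isEmpty z -> G ⊢ ¬ hasPair z.
Proof. by move=> Hz; assume H; obtain w wz Hw from H; apply: empty_elim Hz wz. Qed.

Definition oneRealizer (A : pcaVars) (e : nat) : form :=
  ExIn (car A) (ExIn (car A).+1 (codes (liftA 2 A) e.+2 1 0
    ∧ codes (liftA 2 A) 1 (num0 A).+2 (num0 A).+2
    ∧ constFun (liftA 2 A) 0 (num0 A).+2))%F.

Definition subOneRealizer (A : pcaVars) (e : nat) : form :=
  ExIn (car A) (constFun (liftA 1 A) e.+1 0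
    ∧ codes (liftA 1 A) 0 (num0 A).+1 (num0 A).+1)%F.

Lemma ren_inWDec1 r b : ren r (inWDec1 b) = inWDec1 (r b).
Proof. by []. Qed.
Hint Rewrite ren_inWDec1 : renaming.

Lemma oneRealizer_ex G A : G ⊢ isPCA A -> G ⊢ ExIn (car A) (oneRealizer (liftA 1 A) 0).
Proof.
move=> pca; have n0A := pca_num0 (pcaP pca).
obtain a Ha from (code_ex pca n0A n0A).
obtain b Hb from (const_ex pca n0A).
have [aA _ _ _ _] := codes_elim Ha; have [bA _] := and_elim Hb.
obtain e He from (code_ex pca aA bA); have [eA _ _ _ _] := codes_elim He.
witness e => //; witness a => //; witness b => //.
by apply: prv_andI => //; apply: prv_andI.
Qed.

Lemma subOneRealizer_ex G A :
  G ⊢ isPCA A -> G ⊢ ExIn (car A) (subOneRealizer (liftA 1 A) 0).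
Proof.
move=> pca; have n0A := pca_num0 (pcaP pca).
obtain a Ha from (code_ex pca n0A n0A); have [aA _ _ _ _] := codes_elim Ha.
obtain b Hb from (const_ex pca aA); have [bA _] := and_elim Hb.
by witness b => //; witness a => //; apply: prv_andI.
Qed.

Lemma oneName_pair G A o z : G ⊢ oneName A o z -> G ⊢ pairIn (num0 A) z o.
Proof. by case/and_elim=> _ /and_elim[]. Qed.

Lemma rlz_isOne G A e o z rho x :
  G ⊢ num0 A ∈ car A ->
  G ⊢ oneRealizer A e -> G ⊢ oneName A o z -> rho x = o ->
  G ⊢ rlz A e rho (isOne x).
Proof.
move=> n0A He Ho rho_x; obtain a aA H1 from He; obtain b bA H2 from H1.
have [Ce /and_elim[Ca Cb]] := and_elim H2; have [Hz _] := and_elim Ho.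
apply: rlz_and_intro Ce _ _.
  apply: (rlz_exIn_intro (c := z)) Ca _ _; first by rewrite rho_x; apply: oneName_pair.
  exact: rlz_isEmpty.
apply: rlz_allIn_const Cb _ => f d; intro_world; rewrite rho_x => Hp.
have [E1 E2] := oneName_pairIn Ho Hp; split; first by transport E1.
by apply: rlz_isEmpty; rewrite /=; transport E2.
Qed.

(** A name without pairs is equal to ∅ by any realizer, so a single realizer of
    ∅ ∈ 1 serves for all the elements. *)
Lemma rlz_subset_one G A e o z rho x y :
  G ⊢ subOneRealizer A e -> G ⊢ oneName A o z -> rho y = o ->
  (forall f d G', G ⊑ G' -> G' ⊢ pairIn f d (rho x) ->
     (G' ⊢ f ∈ car A) /\ (G' ⊢ ¬ hasPair d)) ->
  G ⊢ rlz A e rho (isSubset x y).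
Proof.
move=> He Ho rho_y H; apply: exIn_elim He _ => m G' s mA H1; normal H1.
case/and_elim: H1 => Ce Cm; apply: rlz_allIn_const Ce _ => f d G'' s' Hp.
have [fA Hd] : (G'' ⊢ f ∈ car A) /\ (G'' ⊢ ¬ hasPair d).
  by apply: H Hp => ? /s /s'.
have {}Ho : G'' ⊢ oneName A o z by apply: prv_weaken Ho => ? /s /s'.
split=> //; have [Hz _] := and_elim Ho.
apply: (rMem_intro (c := z)) (prv_weaken s' Cm) _ _.
  by rewrite /= rho_y; apply: oneName_pair.
exact: rEql_noPair Hd (empty_noPair Hz).
Qed.

(** * Truth values and their names *)

(** The truth value of 0 ∈ b for b ⊆ 1; stated without naming 0. *)
Definition inhabited (b : nat) : form := ExIn b (isEmpty 0).

Lemma ren_inhabited r b : ren r (inhabited b) = inhabited (r b).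
Proof. by []. Qed.
Hint Rewrite ren_inhabited : renaming.

(** The name {w ∈ base | 0 ∈ b} of the truth value b, where the base is a set
    with a pair: it has a pair if and only if 0 ∈ b, and it equals the base if
    0 ∈ b. *)
Lemma name_ex G base b :
  G ⊢ Ex (All (0 ∈ 1 ↔ 0 ∈ base.+2 ∧ inhabited b.+2)).
Proof. by separate z Hz from base by (inhabited b.+1); witness z. Qed.

Lemma name_subset G base b z :
  G ⊢ All (0 ∈ z.+1 ↔ 0 ∈ base.+1 ∧ inhabited b.+1) -> G ⊢ isSubset z base.
Proof. by move=> Hz; var w in wz; case/and_elim: (iff_mp (all_elim w Hz) wz). Qed.

Lemma name_hasPair G base b z : G ⊢ hasPair base ->
  G ⊢ All (0 ∈ z.+1 ↔ 0 ∈ base.+1 ∧ inhabited b.+1) ->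
  G ⊢ hasPair z ↔ inhabited b.
Proof.
move=> Hbase Hz; apply: prv_andI; assume H.
  obtain w wz Hw from H.
  by case/and_elim: (iff_mp (all_elim w Hz) wz).
obtain w wb H1 from Hbase; witness w => //.
by apply: iff_mpr (all_elim w Hz) _; apply: prv_andI.
Qed.

(** W is large enough to contain the truth values of all names in y. *)
Definition decodes (W y : nat) : form :=
  All (All (All (pairIn 2 1 y.+3 →
    AllIn 0 (isEmpty 0) ∧ (hasPair 1 ↔ inhabited 0) → 0 ∈ W.+3)))%F.

Lemma ren_decodes r W y : ren r (decodes W y) = decodes (r W) (r y).
Proof. by []. Qed.
Hint Rewrite ren_decodes : renaming.

(** Strong collection is applied to the relation between a name c and its truth
    value, over a set containing all c with ⟨a, c⟩ ∈ y.  The set obtained contains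
    the truth values up to extensional equality, hence the truth values. *)
Lemma decodes_ex G y : G ⊢ Ex (decodes 0 y.+1).
Proof.
obtain u Hu from (field_ex G y).
obtain z Hz from (empty_ex G); obtain i Hi from (upair_ex G z z).
have tot : G ⊢ AllIn u (Ex (AllIn 0 (isEmpty 0) ∧ (hasPair 1 ↔ inhabited 0))).
  var c in cu; separate b Hb from i by (hasPair c.+1); witness b.
  apply: prv_andI.
    var t in tb; have [ti _] := and_elim (iff_mp (all_elim t Hb) tb).
    have E : G ⊢ t ≐ z := singleton_elim Hi ti.
    by transport E.
  apply: prv_andI; assume H.
    witness z => //; apply: iff_mpr (all_elim z Hb) _; apply: prv_andI => //.
    by have [] := upair_elim Hi.
  obtain t tb Ht from H.
  by case/and_elim: (iff_mp (all_elim t Hb) tb).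
refine (strong_collection tot _) => W; intro_world => HW _.
witness W; var a; var c; var b; assume Hp; assume H.
have [_ cu] := and_elim (prv_impE (all_elim c (all_elim a Hu)) Hp).
obtain b' bW H' from (allIn_elim HW cu).
have [Hb Hcb] := and_elim H; have [Hb' Hcb'] := and_elim H'.
suff E: G ⊢ b' ≐ b by transport <- E.
apply: extensionality; var t in tb.
  have: G ⊢ inhabited b.
    by apply: iff_mp Hcb (iff_mpr Hcb' _); witness t => //; apply: allIn_elim Hb' tb.
  move=> I; obtain t' tb' Ht' from I.
  have E : G ⊢ t' ≐ t := empty_unique Ht' (allIn_elim Hb' tb).
  by transport <- E.
have: G ⊢ inhabited b'.
  by apply: iff_mp Hcb' (iff_mpr Hcb _); witness t => //; apply: allIn_elim Hb tb.
move=> I; obtain t' tb' Ht' from I.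
have E : G ⊢ t' ≐ t := empty_unique Ht' (allIn_elim Hb tb).
by transport <- E.
Qed.

(** * Absoluteness *)

(** By [rEql_hasPair] the name c found in y has the same truth value as the name
    z of b. *)
Lemma decode G A W y a c v z b :
  G ⊢ decodes W y -> G ⊢ pairIn a c y -> G ⊢ rEql A v z c ->
  G ⊢ AllIn b (isEmpty 0) -> G ⊢ hasPair z ↔ inhabited b -> G ⊢ b ∈ W.
Proof.
move=> HW Hp Hv Hb Hz.
apply: prv_impE (prv_impE (all_elim b (all_elim c (all_elim a HW))) Hp) _.
apply: prv_andI => //; have Hzc := rEql_hasPair Hv; apply: prv_andI; assume H.
  exact: iff_mp Hz (iff_mpr Hzc H).
exact: iff_mp Hzc (iff_mpr Hz H).
Qed.

(** Subsets of {⟨0, ∅⟩} that are weakly decidable in V are realized to be weakly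
    decidable.  The realizer depends on which disjunct holds, but both disjuncts
    are negations, which any element realizes as soon as they hold. *)
Lemma inWDec1_realized G A o z b rho x chi :
  G ⊢ isPCA A -> G ⊢ oneName A o z -> G ⊢ isSubset b o ->
  G ⊢ ¬ hasPair b ∨ ¬ ¬ hasPair b -> rho x = b ->
  (forall r G', G ⊑ G' -> G' ⊢ r ∈ car A -> G' ⊢ rlz A r rho (inWDec1 x) ->
     G' ⊢ chi) ->
  G ⊢ chi.
Proof.
move=> pca Ho Hbo Hdec rho_x Hchi.
suff: G ⊢ ExIn (car A) (rlz (liftA 1 A) 0 (liftv 1 rho) (inWDec1 x)).
  move=> H; apply: exIn_elim H _ => r G' s rA; rewrite inst_rlz.
  exact: Hchi.
clear Hchi.
have n0A := pca_num0 (pcaP pca); have n1A := pca_num1 (pcaP pca).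
have Ho' := oneName_pair Ho.
have memb : G ⊢ hasPair b → pairIn (num0 A) z b.
  assume H; obtain f Hf from (hasPair_elim H); obtain d Hd from Hf.
  have [E1 E2] := oneName_pairIn Ho (pairIn_subset Hbo Hd).
  by transport <- E1; transport <- E2.
(* A realizer of the disjunction at ∅, the only element of the name of 1. *)
have: G ⊢ ExIn (car A) (rlz (liftA 1 A) 0 (liftv 1 (scons z (scons o rho)))
   (¬ (0 ∈ x.+2) ∨ ¬ ¬ (0 ∈ x.+2))).
  cases H from Hdec.
    obtain m Hm from (code_ex pca n0A n0A); have [mA _ _ _ _] := codes_elim Hm.
    apply: exIn_intro mA _; rewrite inst_rlz; apply: rlz_or_intro1 Hm _.
    apply: rlz_not_intro => f; intro_world => fA Hf.
    apply: rMem_elim Hf _ => u v c; intro_world; rewrite /= rho_x => Hp _.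
    exact: not_elim H (hasPair_intro Hp).
  obtain m Hm from (code_ex pca n1A n0A); have [mA _ _ _ _] := codes_elim Hm.
  apply: exIn_intro mA _; rewrite inst_rlz; apply: rlz_or_intro2 Hm _.
  apply: rlz_not_intro => f; intro_world => fA Hf.
  apply: not_elim H _; assume Hb.
  obtain i Hi from (code_ex pca n0A n0A); have [iA _ _ _ _] := codes_elim Hi.
  have [/empty_noPair Hz _] := and_elim Ho.
  apply: rlz_not_elim Hf iA _.
  apply: (rMem_intro (c := z)) Hi _ (rEql_noPair _ _ Hz Hz).
  by rewrite /= rho_x; apply: prv_impE memb Hb.
move=> Hm; apply: exIn_elim Hm _ => m; intro_world => mA; rewrite inst_rlz => Hm.
obtain r1 r1A H1 from (oneRealizer_ex pca).
obtain r2 r2A H2 from (subOneRealizer_ex pca).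
obtain r3 H3 from (const_ex pca mA); have [r3A _] := and_elim H3.
obtain r23 H23 from (code_ex pca r2A r3A); have [r23A _ _ _ _] := codes_elim H23.
obtain r Hr from (code_ex pca r1A r23A); have [rA _ _ _ _] := codes_elim Hr.
apply: exIn_intro rA _; rewrite inst_rlz.
apply: rlz_ex_intro (inV_oneName n0A Ho) _.
apply: rlz_and_intro Hr _ _; first exact: rlz_isOne H1 Ho _.
apply: rlz_and_intro H23 _ _.
  apply: (rlz_subset_one H2 Ho) => // f d; intro_world; rewrite /= rho_x => Hp.
  have [E1 E2] := oneName_pairIn Ho (pairIn_subset Hbo Hp).
  have [/empty_noPair Hz _] := and_elim Ho.
  by split; [transport E1|transport E2].
apply: (rlz_allIn_const H3) => f d; intro_world => Hp.
have [E1 E2] := oneName_pairIn Ho Hp; split; first by transport E1.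
exact: rlz_eql (eql_sym E2) Hm.
Qed.

Lemma models_intro G A e phi :
  G ⊢ e ∈ car A -> G ⊢ rlz A e id phi -> G ⊢ models A phi.
Proof. by move=> eA He; apply: exIn_intro eA _; rewrite inst_rlz. Qed.

(** If f realized that y is the set WDec(1), then f would send the realizer for
    the name of each b ∈ WDec(1) to a realizer of its membership in y.  So all of
    WDec(1) would be contained in the set of truth values of the names in y, and
    Δ₀-separation would make it a set. *)
Lemma WDec1_not_a_set_realized G A :
  G ⊢ isPCA A -> G ⊢ WDec1_not_a_set -> G ⊢ models A WDec1_not_a_set.
Proof.
move=> pca HW; have n0A := pca_num0 (pcaP pca).
apply: (models_intro n0A); apply: rlz_not_intro => f; intro_world => fA Hf.
apply: rlz_ex_elim Hf _ => y; intro_world => yV Hf.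
obtain o Ho1 from (oneName_ex G A); obtain e Ho from Ho1.
have [He _] := and_elim Ho; have oV := inV_oneName n0A Ho.
obtain W Wdec from (decodes_ex G y); have {}Wdec : G ⊢ decodes W y by exact: Wdec.
obtain i Hi from (upair_ex G e e); have [ei _ _] := upair_elim Hi.
have i1 : G ⊢ isOne i.
  apply: prv_andI; first by witness e.
  by var t in ti; have E := singleton_elim Hi ti; transport E.
separate D HD from W
  by (isSubset 0 i.+1 ∧ AllIn i.+1 (¬ (0 ∈ 1) ∨ ¬ ¬ (0 ∈ 1)))%F.
apply: not_elim HW _; witness D; var b; apply: prv_andI; assume H.
  case/and_elim: (iff_mp (all_elim b HD) H) => _ H1.
  by witness i; apply: prv_andI.
obtain i' H1 from H; have [i1' /and_elim[sub dec]] := and_elim H1.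
have E := one_unique i1' i1; transport E in sub; transport E in dec.
have [_ iempty] := and_elim i1.
have bempty : G ⊢ AllIn b (isEmpty 0).
  by var t in tb; apply: allIn_elim iempty (allIn_elim sub tb).
have eb : G ⊢ e ∈ b ↔ inhabited b.
  apply: prv_andI; assume Hb; first by witness e.
  obtain t tb Ht from Hb.
  by have E' := empty_unique Ht He; transport <- E'.
obtain z Hz from (name_ex G o b).
have zb := name_hasPair (hasPair_intro (oneName_pair Ho)) Hz.
have decb := decided_iff eb (allIn_elim dec ei).
have zb' : G ⊢ inhabited b ↔ hasPair z.
  by apply: prv_andI; [apply: prv_andE2 zb|apply: prv_andE1 zb].
have decz := decided_iff zb' decb.
have subz := name_subset Hz.
apply: (inWDec1_realized (rho := scons z (scons y id)) (x := 0) pca Ho subz decz) => //.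
move=> r; intro_world => rA Hr.
apply: rlz_and_elim2 (rlz_all_elim Hf (inV_subset oV subz)) _ => v; intro_world => vA Hv.
apply: withApp_elim (rlz_imp_elim Hv rA Hr) _ => u; intro_world => uA _.
rewrite inst_rlz => Hu; apply: rMem_elim Hu _ => a m c; intro_world => Hac Hm.
apply: iff_mpr (all_elim b HD) _; apply: prv_andI.
  exact: decode Wdec Hac Hm bempty zb.
exact: prv_andI.
Qed.

(** The conclusion x ⊆ 1 is realized by a fixed element, provided that every name
    c of an element of x is without pairs.  If some c had a pair, then for each p
    with ¬¬(p ∈ {1}) the name q = {w ∈ c | 0 ∈ p} is not not equal to c, so that
    ¬¬(q ∈ x) is realized and q is realized to be in the bounding set y.  Thus the
    truth values of the names in y bound the double complement of {1}, and ADCom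
    yields {1} ⊆ 1, which is absurd. *)
Lemma ADCom_realized G A : G ⊢ isPCA A -> G ⊢ ADCom -> G ⊢ models A ADCom.
Proof.
move=> pca ad; have n0A := pca_num0 (pcaP pca).
obtain e eA He from (idRealizer_ex pca).
obtain r1 r1A H1 from (oneRealizer_ex pca).
obtain r2 r2A H2 from (subOneRealizer_ex pca).
obtain r Hr from (code_ex pca r1A r2A); have [rA _ _ _ _] := codes_elim Hr.
obtain k Hk from (const_ex pca rA); have [kA _] := and_elim Hk.
obtain o Ho1 from (oneName_ex G A); obtain z Ho from Ho1.
have [Hz _] := and_elim Ho; have oV := inV_oneName n0A Ho.
apply: (models_intro kA); apply: rlz_all_intro => x; intro_world => xV.
apply: rlz_imp_intro => f; intro_world => fA Hf.
apply: (withApp_intro rA (const_app Hk fA)); rewrite inst_rlz.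
apply: (rlz_ex_intro oV); apply: (rlz_and_intro Hr).
  exact: rlz_isOne H1 Ho _.
apply: (rlz_subset_one H2 Ho) => // h c; intro_world => Hhc.
have {}Hhc : G ⊢ pairIn h c x by exact: Hhc.
have [hA cV] := and_elim (inV_mem xV Hhc); split=> //; assume cpair.
(* i = {∅} is the number 1, and S = {1} *)
obtain i Hi from (upair_ex G z z); obtain S HS from (upair_ex G i i).
have [zi _ _] := upair_elim Hi; have [iS _ _] := upair_elim HS.
apply: rlz_ex_elim Hf _ => y; intro_world => yV Hf.
obtain W Wdec from (decodes_ex G y).
have bounded : G ⊢ Ex (All (¬ ¬ (0 ∈ S.+2) → 0 ∈ 1)).
  witness W; var p; assume Hp.
  have pempty : G ⊢ AllIn p (isEmpty 0).
    var t in tp; var u in ut; assume refl.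
    apply: not_elim Hp _; assume pS; have E := singleton_elim HS pS.
    have E' := singleton_elim Hi (mem_congr E tp).
    exact: empty_elim Hz (mem_congr E' ut).
  obtain q Hq from (name_ex G c p).
  have qp := name_hasPair cpair Hq; have subq := name_subset Hq.
  have Hqx : G ⊢ rlz A (num0 A) (scons q (scons y (scons x id))) (¬ ¬ (0 ∈ 2)).
    apply: rlz_not_intro => g; intro_world => gA Hg.
    apply: not_elim Hp _; assume pS; have E := singleton_elim HS pS.
    have pinh : G ⊢ inhabited p by witness z => //; transport E.
    have qc : G ⊢ c ≐ q.
      apply: extensionality => //; var w in wc.
      by apply: iff_mpr (all_elim w Hq) _; apply: prv_andI.
    obtain m Hm from (code_ex pca hA eA); have [mA _ _ _ _] := codes_elim Hm.
    apply: (rlz_not_elim Hg mA); apply: (rMem_intro Hm Hhc).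
    by transport <- qc; apply: rEql_refl.
  have Himp := rlz_all_elim Hf (inV_subset cV subq).
  apply: withApp_elim (rlz_imp_elim Himp n0A Hqx) _ => u; intro_world => uA _.
  rewrite inst_rlz => Hu; apply: rMem_elim Hu _ => a m c'; intro_world => Hac Hm.
  exact: decode Wdec Hac Hm pempty qp.
obtain j Hj from (prv_impE (all_elim S ad) bounded).
have [/and_elim[_ jempty] Sj] := and_elim Hj.
have iempty := allIn_elim jempty (allIn_elim Sj iS).
exact: empty_elim iempty zi.
Qed.

(* The seven quantifiers bind, from the outside, the components of a pca. *)
Theorem theorem7p5 :
  let A := {| car := 6; graph := 5; pr := 4; pr0 := 3; pr1 := 2;
              num0 := 1; num1 := 0 |} in
  prv CZF [::]
    (All (All (All (All (All (All (All
      (isPCA A →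
        (WDec1_not_a_set → models A WDec1_not_a_set)
        ∧ (ADCom → models A ADCom)))))))))%F.
Proof.
move=> A.
do 7!apply: prv_allI.
apply: imp_intro => G _ pca; apply: prv_andI; apply: imp_intro => G' s H.
  exact: WDec1_not_a_set_realized (prv_weaken s pca) H.
exact: ADCom_realized (prv_weaken s pca) H.
Qed.
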